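(* Let $\mu$ be a nonnegative Borel measure on $\mathbb{R}^+$ with $\mu(\mathbb{R}^+)\in(0,\infty)$, let $\sigma\in C(\mathbb{R}^+;\mathbb{R})$ with $\sigma\notin L^2(0,\infty)$, let $B$ be a standard one-dimensional Brownian motion, and let $f:\mathbb{R}\to\mathbb{R}$ be locally Lipschitz continuous with $\lim_{x\to\infty}f(x)=\infty$. Suppose there is $\phi\in C^1(\mathbb{R}^+;(0,\infty))$ with $\phi'(x)>0$ for all $x\ge0$, $\lim_{x\to\infty}\phi(x)=\infty$, $\phi'$ non-increasing with $\lim_{x\to\infty}\phi'(x)=0$, and $$\lim_{x\to\infty}\frac{f(x)}{\phi(x)}=1,\qquad\lim_{|x|\to\infty}\frac{|f(x)|}{\phi(|x|)}=1.$$ Let $X$ be the unique strong (continuous) solution of $$X(t)=X(0)+\int_0^t m(t-s)f(X(s))\,ds+\int_0^t\sigma(s)\,dB(s),\quad t\ge0,\qquad m(t)=\mu([0,t]).$$ Let $$\Sigma(t)=\sqrt{2\left(\int_0^t\sigma^2(s)\,ds\right)\log\log\left(\int_0^t\sigma^2(s)\,ds\right)},\qquad L_f(\Sigma)=\lim_{t\to\infty}\frac{\Sigma(t)}{\mu(\mathbb{R}^+)\int_{t_0}^t f(\Sigma(s))\,ds}.$$ If $L_f(\Sigma)=\infty$, then $$\liminf_{t\to\infty}\frac{X(t)}{\Sigma(t)}=-1\ \text{ a.s.}\quad\text{and}\quad\limsup_{t\to\infty}\frac{X(t)}{\Sigma(t)}=1\ \text{ a.s.},$$ and furthermore $$\l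im_{t\to\infty}\frac{X(t)-\int_0^t\sigma(s)\,dB(s)}{\Sigma(t)}=0\quad\text{a.s.}$$
   Context: $\mathbb{R}^+=[0,\infty)$. The underlying filtered probability space is complete with right-continuous filtration, $B$ is a Brownian motion with respect to it, and $X(0)$ is a real-valued $\mathcal{F}_0$-measurable initial value. $\Sigma(t)$ is considered only for $t\ge t_0$, where $t_0$ is any fixed time with $\int_0^{t_0}\sigma^2(s)\,ds>e$ (the value of $L_f(\Sigma)$ does not depend on the choice of $t_0$). *)

(* Defs.v *)
From HB Require Import structures.
From mathcomp Require Import all_boot all_order all_algebra.
From mathcomp Require Import all_classical all_reals all_analysis.

Set Implicit Arguments.
Unset Strict Implicit.
Unset Printing Implicit Defensive.

Import Order.TTheory GRing.Theory Num.Theory.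
Import numFieldNormedType.Exports.

Local Open Scope classical_set_scope.
Local Open Scope ring_scope.

(* The time axis [0, +oo[ is represented by the nonnegative part of R: a
   process is a function R -> T -> R (time first), of which only the values at
   times t >= 0 are constrained or used.  The same convention applies to
   functions and measures on [0, +oo[. *)

Section Analysis.
Context {R : realType}.

(* the filter "|x| --> +oo" on R *)
Definition norm_pinfty_nbhs : set_system R :=
  filter_from setT (fun M : R => [set x | M < `|x|]).

Definition locally_lipschitz (f : R -> R) : Prop :=
  forall x : R, exists2 U : set R, nbhs x U & [lipschitz f y | y in U].

(* phi is C^1 on [0, +oo[ with derivative dphi; the difference quotients only
   use points of [0, +oo[, so that the derivative at 0 is one-sided. *)
Definition C1_halfline (phi dphi : R -> R) : Prop :=
  (forall x : R, 0 <= x ->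
     (phi y - phi x) / (y - x) @[y --> within `[0, +oo[ x^'] --> dphi x) /\
  {within `[0, +oo[, continuous dphi}.

(* m(t) = mu([0, t]) *)
Definition mu_upto (mu : {measure set (measurableTypeR R) -> \bar R})
  (t : R) : R := fine (mu `[0, t]%classic).

(* int_0^t sigma(s)^2 ds *)
Definition int_sqr (sigma : R -> R) (t : R) : R :=
  \int[lebesgue_measure]_(s in `[0, t]) (sigma s ^+ 2).

Definition Sigma (sigma : R -> R) (t : R) : R :=
  Num.sqrt (2 * int_sqr sigma t * ln (ln (int_sqr sigma t))).

(* the quotient whose limit at +oo is L_f(Sigma) *)
Definition Lf_quotient (mu : {measure set (measurableTypeR R) -> \bar R})
  (f sigma : R -> R) (t0 t : R) : R :=
  Sigma sigma t / (fine (mu `[0, +oo[%classic) *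
    \int[lebesgue_measure]_(s in `[t0, t]) f (Sigma sigma s)).

(* the step function step_height * 1_(]step_left, step_right]) *)
Record step := Step {
  step_height : R ;
  step_left : R ;
  step_right : R ;
  step_wf : 0 <= step_left <= step_right }.

Definition step_fun (s : seq step) (x : R) : R :=
  \sum_(p <- s) step_height p * \1_(`]step_left p, step_right p]) x.

End Analysis.
Arguments step : clear implicits.
Arguments norm_pinfty_nbhs : clear implicits.

Section Processes.
Context {R : realType} {d : measure_display} {T : measurableType d}.
Variable P : probability T R.

Record usual_conditions (F : R -> set_system T) : Prop := {
  uc_complete : measure_is_complete P ;
  uc_sigma_algebra : forall t : R, 0 <= t -> sigma_algebra setT (F t) ;
  uc_measurable : forall t : R, 0 <= t -> F t `<=` measurable ;
  uc_mono : forall s t : R, 0 <= s -> s <= t -> F s `<=` F t ;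
  uc_right_continuous : forall t : R, 0 <= t ->
    \bigcap_(u in [set u | t < u]) F u `<=` F t ;
  uc_negligible : P.-negligible `<=` F 0 }.

Definition adapted (F : R -> set_system T) (X : R -> T -> R) : Prop :=
  forall t : R, 0 <= t ->
  forall U : set R, measurable U -> F t (X t @^-1` U).

Definition continuous_paths (X : R -> T -> R) : Prop :=
  {ae P, forall w, {within `[0, +oo[, continuous (fun t => X t w)}}.

Definition increment (X : R -> T -> R) (s t : R) (w : T) : R :=
  X t w - X s w.

(* standard one-dimensional Brownian motion relative to the filtration F;
   the second argument of normal_prob is the standard deviation *)
Record brownian_motion (F : R -> set_system T) (B : R -> T -> R) : Prop := {
  bm_adapted : adapted F B ;
  bm_continuous : continuous_paths B ;
  bm_start : {ae P, forall w, B 0 w = 0} ;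
  bm_indep : forall s t : R, 0 <= s -> s < t ->
    forall (A : set T) (U : set R), F s A -> measurable U ->
    P (A `&` increment B s t @^-1` U) =
    (P A * P (increment B s t @^-1` U))%E ;
  bm_gauss : forall s t : R, 0 <= s -> s < t ->
    forall U : set R, measurable U ->
    P (increment B s t @^-1` U) =
    normal_prob 0 (Num.sqrt (t - s)) U }.

(* integral over [0, t] against B of the step function represented by s *)
Definition step_integral (B : R -> T -> R) (s : seq (step R)) (t : R) (w : T)
  : R :=
  \sum_(p <- s) step_height p *
    increment B (Num.min (step_left p) t) (Num.min (step_right p) t) w.

(* I is (a continuous version of) the process int_0^t sigma(s) dB(s), for a
   deterministic integrand sigma: on every [0, t] it is the limit in L^2(P) of
   the integrals of step functions converging to sigma in L^2(0, t).  By the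
   isometry property for step functions, this determines I up to
   indistinguishability, whatever the approximating sequences. *)
Record wiener_integral (F : R -> set_system T) (B : R -> T -> R)
    (sigma : R -> R) (I : R -> T -> R) : Prop := {
  wi_adapted : adapted F I ;
  wi_continuous : continuous_paths I ;
  wi_limit : forall t : R, 0 <= t -> exists s : nat -> seq (step R),
    (\int[lebesgue_measure]_(x in `[0%R, t])
       ((step_fun (s n) x - sigma x) ^+ 2)%:E)%E @[n --> \oo] --> 0%E /\
    forall u : R, 0 <= u -> u <= t ->
      ('E_P[fun w => ((I u w - step_integral B (s n) u w) ^+ 2)%R])%E
         @[n --> \oo] --> 0%E }.

(* continuous adapted solution of
     X(t) = X(0) + int_0^t m(t - s) f(X(s)) ds + I(t), t >= 0;
   adaptedness at t = 0 says that X(0) is F_0-measurable *)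
Record volterra_solution (F : R -> set_system T)
    (mu : {measure set (measurableTypeR R) -> \bar R}) (f : R -> R)
    (I : R -> T -> R) (X : R -> T -> R) : Prop := {
  vs_adapted : adapted F X ;
  vs_continuous : continuous_paths X ;
  vs_eq : {ae P, forall w, forall t : R, 0 <= t ->
    X t w = X 0 w +
      \int[lebesgue_measure]_(s in `[0, t])
        (mu_upto mu (t - s) * f (X s w)) + I t w} }.

End Processes.

(* Main.v *)
(* The drift D = X - I is controlled pathwise by z = |X(0)| + 1 + int M |f(X)|,
   where M = mu([0, +oo[).  If |I| <= 2 Sigma eventually, then
   z' <= K (phi(Sigma) + phi(z)), whereas a = N int f(Sigma) satisfies
   a' >= (2 K + 1) phi(Sigma) for N large, and a <= Sigma eventually because
   L_f(Sigma) = +oo.  By concavity of phi, the quotient (z - a) / phi(a)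
   decreases at rate at least 1 while it is nonnegative; hence z <= a
   eventually, and a = o(Sigma).

   The law of the iterated logarithm for I only uses inequalities: Gaussian
   bounds for the increments of I, conditionally on the past, obtained from step
   integrands by L^2 approximation.  The upper bound follows from Levy's maximal
   inequality on dyadic grids and the first Borel-Cantelli lemma along times
   where the variance is q^n, q close to 1; the lower bound from independent
   increments along the same kind of times with q large. *)

Require Import Defs.
From HB Require Import structures.
From mathcomp Require Import all_boot all_order all_algebra.
From mathcomp Require Import all_classical all_reals all_analysis.
From mathcomp Require Import measurable_realfun.
From mathcomp Require Import ring lra.

Set Implicit Arguments.
Unset Strict Implicit.
Unset Printing Implicit Defensive.

Import Order.TTheory GRing.Theory Num.Theory.
Import numFieldNormedType.Exports.

Local Open Scope classical_set_scope.
Local Open Scope ring_scope.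

(** * A comparison lemma for concave rates *)

(** An exact Gaussian law for [I] would have to be carried through an [L^2] limit; a tail inequality
    passes at once if it may lose a little in the level and in the variance. Hence the pairs of
    levels [x], [y] and the two-sided bounds on variances in the probabilistic estimates, and hence
    the margins [e] that are split into several parts. The integrand may vanish on whole intervals,
    so the variance [int_sqr sigma] need not be strictly increasing and there is no inverse clock;
    times are only chosen with a prescribed variance. Both signs come from one argument, since [- I]
    is the integral of [- sigma] against the same [B]. The upper bounds for [I] and [- I] are prior
    to everything else: the lower bound needs control of the value at the preceding time, and the
    drift needs [|I| <= 2 * Sigma]. Once that bound holds on a path, the drift estimate is
    deterministic. *)

Lemma eventually_le0 (R : realType) (r dr : R -> R) (T : R) :
  (forall t, T < t -> is_derive t 1 r (dr t)) ->
  (forall t, T < t -> 0 <= r t -> dr t <= -1) ->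
  \forall t \near +oo, r t <= 0.
Proof.
move=> dr_ dr1.
have cr a b : T < a -> {within `[a, b], continuous r}.
  move=> Ta; apply: derivable_within_continuous => x.
  rewrite in_itv/= => /andP[ax _].
  by have [] := dr_ x (lt_le_trans Ta ax).
have [t1 Tt1 rt1] : exists2 t1, T < t1 & r t1 <= 0.
  apply: contrapT => /forall2NP rpos.
  have {}rpos t : T < t -> 0 < r t.
    by move=> Tt; have [//|/negP] := rpos t; rewrite -ltNge.
  have rT := rpos (T + 1) ltac:(lra).
  (* The interval has length [1 + r (T + 1)], so a mean slope of at most -1 would bring [r] down to
     -1 or below. *)
  have [|t||c] := @MVT R r dr (T + 1) (T + 2 + r (T + 1)).
  - lra.
  - by rewrite in_itv/= => /andP[? ?]; apply: dr_; lra.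
  - by apply: cr; lra.
  rewrite in_itv/= => /andP[Tc cT] E.
  have := dr1 c ltac:(lra) ltac:(apply/ltW/rpos; lra).
  have := rpos (T + 2 + r (T + 1)) ltac:(lra).
  nra.
exists t1; split; first exact: num_real.
move=> t /= t1t; rewrite leNgt; apply/negP => rt.
(* Once nonpositive, [r] stays so: at a positive maximum over [[t1, t]] the left difference
   quotients are nonnegative, against a derivative of at most -1. *)
have [c + cmax] := EVT_max (ltW t1t) (cr t1 t Tt1).
rewrite in_itv/= => /andP[t1c ct].
have rc : 0 < r c by apply: lt_le_trans rt (cmax _ _); rewrite in_itv/= lexx ltW.
have {}t1c : t1 < c by rewrite lt_neqAle t1c andbT; apply: contraTneq rc => <-; rewrite -leNgt.
have Tc : T < c by lra.
have [dc dcE] := dr_ c Tc.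
have drc := dr1 c Tc (ltW rc).
have : h^-1 *: (r (h *: 1 + c) - r c) @[h --> (0 : R)^'] --> 'D_1 r c by exact: dc.
rewrite dcE => /cvgr_lt /(_ 0 ltac:(lra)) [e /= e0 He].
(* The increment is negative because [c] may be the right end [t]. *)
pose h := - Num.min (e / 2) ((c - t1) / 2).
have h0 : h < 0 by rewrite /h oppr_lt0 lt_min; apply/andP; split; lra.
have he : - h <= e / 2 by rewrite /h opprK ge_min lexx.
have hc : - h <= (c - t1) / 2 by rewrite /h opprK ge_min lexx orbT.
have := He h; rewrite /ball/= sub0r normrN ltr0_norm// => /(_ ltac:(lra) ltac:(lra)).
have := cmax (h + c); rewrite in_itv/= => /(_ ltac:(lra)).
rewrite /GRing.scale/= mulr1 -subr_le0 nmulr_rlt0 ?invr_lt0//.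
by move=> /le_lt_trans /[apply]; rewrite ltxx.
Qed.

Section concave_function.
Context {R : realType} (phi dphi : R -> R).
Hypotheses (hphi : C1_halfline phi dphi)
  (phi_gt0 : forall x : R, 0 <= x -> 0 < phi x)
  (dphi_gt0 : forall x : R, 0 <= x -> 0 < dphi x)
  (dphi_mono : forall x y : R, 0 <= x -> x <= y -> dphi y <= dphi x).

Lemma C1_halfline_is_derive (x : R) : 0 < x -> is_derive x 1 phi (dphi x).
Proof.
move=> x0.
suff H : (h^-1 *: (phi (h *: 1 + x) - phi x)) @[h --> (0 : R)^'] --> dphi x.
  apply: DeriveDef; first by apply/cvg_ex; exists (dphi x).
  by rewrite /derive; apply/cvg_lim => //; exact: Rhausdorff.
have /cvgrPdist_lt /= H := hphi.1 x (ltW x0).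
apply/cvgrPdist_lt => e e0; have := H e e0.
move=> -[d /= d0 Hd]; exists (Num.min d x) => /=; first by rewrite lt_min d0.
move=> h; rewrite /ball/= sub0r normrN lt_min => /andP[hd hx] h0.
have -> : h *: 1 + x = h + x by rewrite /GRing.scale/= mulr1.
have := Hd (h + x); rewrite /ball/= opprD addrCA subrr addr0 normrN => /(_ hd).
rewrite addrK /GRing.scale/= mulrC; apply.
  by rewrite -subr_eq0 addrK.
by rewrite in_itv/= andbT; move: hx; rewrite ltr_norml => /andP[? _]; lra.
Qed.

Lemma concave_slope (x y : R) : 0 < x -> x < y ->
  exists2 c, x < c < y & phi y - phi x = dphi c * (y - x).
Proof.
move=> x0 xy; have [||c] := @MVT R phi dphi x y xy.
- by move=> z; rewrite in_itv/= => /andP[? ?]; apply: C1_halfline_is_derive; lra.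
- apply: derivable_within_continuous => z; rewrite in_itv/= => /andP[xz _].
  by have [] := C1_halfline_is_derive (lt_le_trans x0 xz).
- by rewrite in_itv/=; exists c.
Qed.

Lemma concave_homo (x y : R) : 0 < x -> x <= y -> phi x <= phi y.
Proof.
move=> x0; rewrite le_eqVlt => /predU1P[->//|xy].
have [c /andP[xc cy] E] := concave_slope x0 xy.
have := dphi_gt0 (ltW (lt_trans x0 xc)).
rewrite -subr_ge0 E => dc; nra.
Qed.

Lemma concave_tangent (x y : R) : 0 < x -> x <= y ->
  phi y <= phi x + dphi x * (y - x).
Proof.
move=> x0; rewrite le_eqVlt => /predU1P[->//|xy]; first by rewrite subrr mulr0 addr0.
have [c /andP[xc cy] E] := concave_slope x0 xy.
have := dphi_mono (ltW x0) (ltW xc).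
rewrite -lerBlDl E => dc; nra.
Qed.

(** The tangent at [x] costs [dphi x * x], and the mean value theorem on [[x / 2, x]] bounds half of
    this by [phi x]. Starting at [x / 2] instead of 0 avoids the one-sided derivative, at the price
    of 3 instead of 2. *)
Lemma concave_double (x : R) : 0 < x -> phi (2 * x) <= 3 * phi x.
Proof.
move=> x0; have x20 : 0 < x / 2 by lra.
have [c /andP[xc cy] E] := @concave_slope (x / 2) x x20 ltac:(lra).
have := @dphi_mono c x ltac:(lra) (ltW cy).
have := @concave_tangent x (2 * x) x0 ltac:(lra).
have := phi_gt0 (ltW x20).
nra.
Qed.

Lemma concave_add (x y : R) : 0 < x -> 0 < y -> phi (x + y) <= 3 * (phi x + phi y).
Proof.
wlog xy : x y / x <= y.
  move=> H x0 y0; have [xy|yx] := leP x y; first exact: H.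
  by rewrite addrC [phi x + _]addrC H // ltW.
move=> x0 y0; apply: (@le_trans _ _ (phi (2 * y))).
  by apply: concave_homo; lra.
have := concave_double y0; have := phi_gt0 (ltW x0); lra.
Qed.

(* The quotient [(z - a) / phi a] has slope at most [-1] where it is nonnegative,
   since [phi z <= phi a + dphi a * (z - a)] by concavity. *)
Lemma concave_comparison (z dz a da S : R -> R) (K T : R) :
  0 <= K ->
  (forall t, T < t -> is_derive t 1 z (dz t)) ->
  (forall t, T < t -> is_derive t 1 a (da t)) ->
  (forall t, T < t -> 0 < a t <= S t) ->
  (forall t, T < t -> dz t <= K * (phi (S t) + phi (z t))) ->
  (forall t, T < t -> (2 * K + 1) * phi (S t) <= da t) ->
  \forall t \near +oo, z t <= a t.
Proof.
move=> K0 hz ha haS hdz hda.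
pose r t := (z t - a t) * (phi (a t))^-1.
pose dr t := (dz t - da t) * (phi (a t))^-1 -
             (z t - a t) * ((phi (a t)) ^- 2 * (dphi (a t) * da t)).
have pa t : T < t -> 0 < phi (a t).
  by move=> /haS/andP[/ltW a0 _]; exact: phi_gt0.
have : \forall t \near +oo, r t <= 0.
  apply: (@eventually_le0 _ r dr T).
    move=> t Tt; rewrite /r /dr.
    have /andP[a0 aS] := haS t Tt.
    have hzt := hz t Tt; have hat := ha t Tt.
    have hp : is_derive (a t) 1 phi (dphi (a t)) by exact: C1_halfline_is_derive.
    have hpa : is_derive t 1 (phi \o a) (da t * dphi (a t)).
      by have := @is_derive1_comp _ phi a t _ _ hp hat; rewrite mulrC.
    have hn : (phi \o a) t != 0 by rewrite /= gt_eqF ?pa.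
    have hv := is_deriveV hn hpa.
    have hza := is_deriveB hzt hat.
    have := is_deriveM hza hv.
    move=> H; apply: (is_derive_eq H); rewrite /GRing.scale/= !fctE; ring.
  move=> t Tt; rewrite /r /dr.
  have /andP[a0 aS] := haS t Tt; have p0 := pa t Tt.
  rewrite pmulr_lge0 ?invr_gt0// subr_ge0 => za.
  have tg := concave_tangent a0 za.
  have pS := concave_homo a0 aS.
  have d0 := dphi_gt0 (ltW a0).
  have := hdz t Tt; have := hda t Tt.
  move: (z t - a t) (subr_ge0 (a t) (z t)) tg => g; rewrite za => g0.
  move: (phi (a t)) (phi (S t)) (phi (z t)) (dphi (a t)) (dz t) (da t) p0 pS d0
    => p ps pz d dz' da' p0 pS d0 tg H1 H2.
  have -> : (dz' - da') * p^-1 - g * (p ^- 2 * (d * da')) =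
     ((dz' - da') * p - g * d * da') / p ^+ 2 by field; rewrite gt_eqF.
  rewrite ler_pdivrMr ?exprn_gt0//.
  (* In [2 * K + 1], one [K] pays for [phi (S t)], the other for [phi (a t) <= phi (S t)], and the 1
     gives the slope -1. The tangent excess [K * d * g] is paid by [g * d * da'], which comes from
     the growth of the denominator [phi (a t)]. *)
  have gd : 0 <= g * d by rewrite mulr_ge0// ltW.
  have K1 : (2 * K + 1) * p <= da' by nra.
  have : g * d * ((2 * K + 1) * p) <= g * d * da' by rewrite ler_wpM2l.
  have : (dz' - da') * p <= (K * (ps + (p + d * g)) - (2 * K + 1) * ps) * p.
    rewrite ler_pM2r//; nra.
  have : 0 <= (K + 1) * (g * d) * p by rewrite !mulr_ge0//; lra.
  have : 0 <= (K + 1) * (ps - p) * p by rewrite !mulr_ge0//; lra.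
  rewrite expr2; lra.
apply: filterS2; last by exists T; split; [exact: num_real|exact: pa].
by move=> t p0; rewrite /r pmulr_lle0 ?invr_gt0// subr_le0.
Qed.

End concave_function.

(** * The drift *)

Section halfline_calculus.
Context {R : realType}.
Implicit Types (f g : R -> R) (a b t : R).

Lemma locally_lipschitz_continuous f : locally_lipschitz f -> continuous f.
Proof.
move=> lip x; have [U nU [k [kr kU]]] := lip x.
have k0 : 0 < `|k| + 1 by have := normr_ge0 k; lra.
have /(_ _)/= := kU (`|k| + 1); rewrite (le_lt_trans (ler_norm _)) ?ltrDl// => /(_ isT) {}kU.
apply/cvgrPdist_le => e e0.
near=> y.
have Uxy : (U `*` U) (x, y).
  by split => /=; [exact: nbhs_singleton|near: y].
apply: (le_trans (kU (x, y) Uxy)) => /=.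
rewrite -ler_pdivlMl//.
near: y; apply: cvgr_dist_le; first exact: cvg_id.
by rewrite mulr_gt0// invr_gt0.
Unshelve. all: end_near. Qed.

Lemma within_halfline_continuous g a t : {within `[a, +oo[, continuous g} ->
  a < t -> {for t, continuous g}.
Proof. by move=> /continuous_within_itvcyP[+ _] at_; apply; rewrite in_itv/= at_. Qed.

Lemma within_continuous_comp (A : set R) f g : {within A, continuous g} ->
  continuous f -> {within A, continuous (f \o g)}.
Proof.
by move=> cg cf x; exact: (@continuous_comp (subspace A) R R g f x (cg x) (cf _)).
Qed.

Lemma within_halfline_sub g a b t : {within `[a, +oo[, continuous g} ->
  a <= b -> {within `[b, t], continuous g}.
Proof.
move=> + ab; apply: continuous_subspaceW => x /=.
by rewrite !in_itv/= andbT => /andP[+ _]; exact: le_trans.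
Qed.

Lemma halfline_integrable g a b t : {within `[a, +oo[, continuous g} ->
  a <= b -> lebesgue_measure.-integrable `[b, t] (EFin \o g).
Proof.
move=> cg ab; apply: continuous_compact_integrable; first exact: segment_compact.
exact: within_halfline_sub cg ab.
Qed.

Lemma halfline_FTC g a t : {within `[a, +oo[, continuous g} -> a < t ->
  is_derive t 1 (fun y => \int[lebesgue_measure]_(s in `[a, y]) g s)%R (g t).
Proof.
move=> cg at_; have t1 : t < t + 1 by rewrite ltrDl.
have [] := @continuous_FTC1_closed R g a t (t + 1) t1
  (halfline_integrable (t + 1) cg (lexx a)) at_ (within_halfline_continuous cg at_).
by rewrite derive1E => d <-; exact: derivableP.
Qed.

End halfline_calculus.

Lemma norm_pinfty_nbhs_filter (R : realType) : Filter (norm_pinfty_nbhs R).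
Proof.
apply: filter_from_filter; first by exists 0.
move=> i j _ _; exists (Num.max i j) => // x /=.
by rewrite gt_max => /andP[].
Qed.

Section drift.
Context {R : realType} (f phi dphi : R -> R).
Hypotheses (hphi : C1_halfline phi dphi)
  (phi_gt0 : forall x : R, 0 <= x -> 0 < phi x)
  (dphi_gt0 : forall x : R, 0 <= x -> 0 < dphi x)
  (dphi_mono : forall x y : R, 0 <= x -> x <= y -> dphi y <= dphi x)
  (cf : continuous f)
  (hf_phi : f x / phi x @[x --> +oo] --> (1 : R))
  (hf_phi_abs : `|f x| / phi `|x| @[x --> norm_pinfty_nbhs R] --> (1 : R)).

(** For large [|x|] the limit of the ratio gives the factor 2. On the remaining compact interval
    [|f|] is bounded, and the floor [1 <= y] compares that bound with [phi 1 <= phi y]. *)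
Lemma dominated_by_concave :
  exists2 K : R, 0 < K & forall x y : R, 1 <= y -> `|x| <= y -> `|f x| <= K * phi y.
Proof.
have NF := norm_pinfty_nbhs_filter R.
have /cvgr_le /(_ 2) := hf_phi_abs; rewrite ltr1n => /(_ isT) [M0 _ HM0].
have [M M1 M0M] : exists2 M : R, 1 <= M & M0 <= M.
  by exists (Num.max M0 1); rewrite le_max lexx ?orbT.
have MM : - M <= M by lra.
have [c _ fc] : exists2 c, c \in `[- M, M] & forall t, t \in `[- M, M] -> `|f t| <= `|f c|.
  apply: (@EVT_max R (fun t => `|f t|)) => //.
  by apply: continuous_subspaceT => x; apply: cvg_norm; exact: cf.
have p1 := phi_gt0 (@ler01 R).
have [K K2 Kc] : exists2 K : R, 2 <= K & `|f c| / phi 1 <= K.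
  by exists (Num.max 2 (`|f c| / phi 1)); rewrite le_max lexx ?orbT.
exists K; first by rewrite (lt_le_trans _ K2).
move=> x y y1 xy.
have p1y : phi 1 <= phi y by exact: (concave_homo hphi dphi_gt0).
have [xM|Mx] := leP `|x| M.
  apply: (@le_trans _ _ (K * phi 1)).
    rewrite -ler_pdivrMr//; apply: le_trans Kc.
    by rewrite ler_pM2r ?invr_gt0// fc// in_itv/= -ler_norml.
  by rewrite ler_wpM2l//; lra.
have x0 : 0 < `|x| by lra.
have px := phi_gt0 (ltW x0).
have := HM0 x (le_lt_trans M0M Mx); rewrite /= ler_pdivrMr// => /le_trans; apply.
apply: (@le_trans _ _ (K * phi `|x|)); first by rewrite ler_wpM2r// ltW.
by rewrite ler_wpM2l ?(concave_homo hphi dphi_gt0)//; lra.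
Qed.

Variables (S : R -> R) (M t0 : R).
Hypotheses (cS : {within `[t0, +oo[, continuous S}) (M_gt0 : 0 < M) (t0_ge0 : 0 <= t0)
  (S_gt0 : forall t : R, t0 <= t -> 0 < S t) (S_lim : S t @[t --> +oo] --> +oo)
  (hL : S t / (M * \int[lebesgue_measure]_(s in `[t0, t]) f (S s)) @[t --> +oo] --> +oo).

Variables (m x i : R -> R).
Hypotheses (m_homo : {homo m : s t / s <= t}) (m_bnd : forall t : R, 0 <= m t <= M)
  (cx : {within `[0, +oo[, continuous x})
  (hx : forall t : R, 0 <= t ->
     x t = x 0 + \int[lebesgue_measure]_(s in `[0, t]) (m (t - s) * f (x s)) + i t)
  (hi : \forall t \near +oo, `|i t| <= 2 * S t).

(** Replacing the kernel by its bound [M] removes the convolution, so that the derivative involves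
    only the current value of [x]. The summand 1 keeps [z] in the range where [dominated_by_concave]
    applies. *)
Let z (t : R) : R := `|x 0| + 1 + \int[lebesgue_measure]_(s in `[0, t]) (M * `|f (x s)|).

Let cMfx : {within `[0, +oo[, continuous (fun s => M * `|f (x s)|)}.
Proof.
apply: (@within_continuous_comp _ _ (fun y => M * `|f y|) x cx) => y.
by apply: cvgM; [exact: cvg_cst|apply: cvg_norm; exact: cf].
Qed.

Let cfx : {within `[0, +oo[, continuous (f \o x)}.
Proof. exact: within_continuous_comp. Qed.

Let z_ge1 t : 1 <= z t.
Proof.
have := normr_ge0 (x 0).
have : 0 <= \int[lebesgue_measure]_(s in `[0, t]) (M * `|f (x s)|).
  by apply: Rintegral_ge0 => s _; rewrite mulr_ge0// ltW.
rewrite /z; lra.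
Qed.

Let drift_le t : 0 <= t -> `|x t - i t| <= z t.
Proof.
move=> t_ge0; rewrite (hx t_ge0) addrK /z.
apply: (le_trans (ler_normD _ _)); rewrite -addrA lerD2l.
apply: ler_wpDl => //.
have mE : measurable_fun `[0, t]%classic (fun s => m (t - s) * f (x s)).
  apply: measurable_funM.
    apply: (@nonincreasing_measurable _ _ (fun s => m (t - s))) => // a b ab.
    by apply: m_homo; rewrite lerD2l lerN2.
  have := halfline_integrable t cfx (lexx 0).
  by move=> /integrableP[/measurable_EFinP].
have mi : forall s, `|m (t - s) * f (x s)| <= `|M * `|f (x s)| |.
  move=> s; have /andP[m0 mM] := m_bnd (t - s).
  by rewrite !normrM normr_id ler_wpM2r// (ger0_norm m0) gtr0_norm.
have iMf := halfline_integrable t cMfx (lexx 0).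
have iE : lebesgue_measure.-integrable `[0, t] (EFin \o (fun s => m (t - s) * f (x s))).
  apply: le_integrable iMf => //; first exact/measurable_EFinP.
  by move=> s _ /=; rewrite lee_fin.
apply: (le_trans (le_normr_Rintegral _ iE)) => //.
apply: le_Rintegral => //.
- by apply: (integrable_norm iE).
- by move=> s _; apply: le_trans (mi s) _; rewrite ger0_norm// mulr_ge0// ltW.
Qed.

Let A (t : R) : R := \int[lebesgue_measure]_(s in `[t0, t]) f (S s).

Let A_le N : 0 < N -> \forall t \near +oo, 0 < A t /\ N * A t <= S t.
Proof.
move=> N0; near=> t.
have St : 0 < S t by apply: S_gt0; near: t; exact: nbhs_pinfty_ge (num_real _).
have q : N / M < S t / (M * A t) by near: t; exact: cvgry_gt.
(* The sign of the integral is read off the quotient, which is eventually positive with a positive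
   numerator; a zero denominator would give the quotient 0. *)
have MA0 : 0 < M * A t.
  have : 0 < S t / (M * A t) by rewrite (lt_trans _ q)// divr_gt0.
  by rewrite pmulr_rgt0// invr_gt0.
split; first by rewrite pmulr_rgt0 in MA0.
move: q; rewrite ltr_pdivlMr// => /ltW; rewrite mulrA divfK ?gt_eqF//.
Unshelve. all: by end_near. Qed.

Theorem drift_negligible : (x t - i t) / S t @[t --> +oo] --> (0 : R).
Proof.
have [K K0 HK] := dominated_by_concave.
(* The 9 comes from [phi (z + 2 * S) <= 3 * (phi z + phi (2 * S)) <= 3 * phi z + 9 * phi S]. *)
pose K' := 9 * M * K.
have K'0 : 0 < K' by rewrite !mulr_gt0.
(* The leading 2 compensates [phi (S t) <= 2 * f (S t)]. *)
pose N := 2 * (2 * K' + 1).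
have N0 : 0 < N by rewrite /N; lra.
(* A fixed multiple of [A] is enough: [A_le] with [N / e] turns [N * A t] into at most [e * S t],
   for every [e]. *)
suff zA : \forall t \near +oo, z t <= N * A t.
  apply/cvgr0Pnorm_le => e e0; near=> t.
  have t_ge0 : 0 <= t by near: t; exact: nbhs_pinfty_ge (num_real _).
  have St : 0 < S t by apply: S_gt0; near: t; exact: nbhs_pinfty_ge (num_real _).
  rewrite normrM normrV ?unitfE ?gt_eqF// (gtr0_norm St) ler_pdivrMr//.
  apply: (le_trans (drift_le t_ge0)).
  have zt : z t <= N * A t by near: t.
  have [] : 0 < A t /\ N / e * A t <= S t by near: t; apply: A_le; rewrite divr_gt0.
  move=> A0 AS; apply: (le_trans zt).
  by move: AS; rewrite mulrAC ler_pdivrMr// [e * _]mulrC.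
have [T HT] : exists T, forall t, T < t ->
  [/\ t0 < t, 0 < A t, N * A t <= S t, 1 <= S t & `|i t| <= 2 * S t /\ phi (S t) <= 2 * f (S t)].
  suff : \forall t \near +oo,
     [/\ t0 < t, 0 < A t, N * A t <= S t, 1 <= S t & `|i t| <= 2 * S t /\ phi (S t) <= 2 * f (S t)].
    by move=> [T [_ HT]]; exists T.
  near=> t.
  have [A0 AS] : 0 < A t /\ N * A t <= S t by near: t; exact: A_le.
  have S1 : 1 <= S t by near: t; exact: cvgry_ge.
  have i2 : `|i t| <= 2 * S t by near: t.
  split => //; first by near: t; exact: nbhs_pinfty_gt (num_real _).
  split => //.
  have : 2^-1 <= f (S t) / phi (S t).
    near: t; apply: (@cvgr_ge _ _ _ _ (fun t => f (S t) / phi (S t)) 1); last by lra.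
    exact: (cvg_comp S (fun y => f y / phi y) S_lim hf_phi).
  have p0 : 0 < phi (S t) by apply: phi_gt0; lra.
  by rewrite ler_pdivlMr//; lra.
have T0 t : T < t -> 0 < t by move=> /HT[tp _ _ _ _]; exact: le_lt_trans tp.
have cfS : {within `[t0, +oo[, continuous (f \o S)} by exact: within_continuous_comp.
apply: (@concave_comparison R phi dphi hphi phi_gt0 dphi_gt0 dphi_mono z (fun t => M * `|f (x t)|)
   (fun t => N * A t) (fun t => N * f (S t)) S K' T).
- exact: ltW.
- move=> t /T0 tp.
  have := halfline_FTC cMfx tp.
  have : is_derive t 1 (cst (`|x 0| + 1) : R -> R) 0 by exact: is_derive_cst.
  move=> H1 H2; have := is_deriveD H1 H2.
  by rewrite add0r.
- move=> t /HT[tp _ _ _ _].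
  have := halfline_FTC cfS tp => H.
  by have := @is_deriveZ _ _ _ A N t 1 _ H.
- move=> t /HT[_ A0 AS _ _]; rewrite AS andbT; exact: mulr_gt0.
- move=> t Tt /=; have t_ge0 := ltW (T0 t Tt); have [_ _ _ S1 [i2 _]] := HT t Tt.
  have z1 := z_ge1 t.
  have xz : `|x t| <= z t + 2 * S t.
    have -> : x t = (x t - i t) + i t by rewrite subrK.
    by rewrite (le_trans (ler_normD _ _))// lerD// drift_le.
  move: (z t) (S t) (x t) z1 S1 xz => zt St xt z1 S1 xz {Tt t_ge0 i2}.
  have y1 : 1 <= zt + 2 * St by lra.
  have zt0 : 0 < zt by lra.
  have St0 : 0 < St by lra.
  have St20 : 0 < 2 * St by lra.
  have := HK xt _ y1 xz.
  have := concave_add hphi phi_gt0 dphi_gt0 dphi_mono zt0 St20.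
  have := concave_double hphi phi_gt0 dphi_mono St0.
  have pz : 0 < phi zt by exact: phi_gt0 (ltW _).
  have pS : 0 < phi St by exact: phi_gt0 (ltW _).
  move=> H1 H2 H3.
  have H4 : phi (zt + 2 * St) <= 9 * (phi St + phi zt) by lra.
  have -> : K' * (phi St + phi zt) = M * (K * (9 * (phi St + phi zt))).
    by rewrite /K'; ring.
  apply: ler_wpM2l; first exact: ltW.
  by apply: (le_trans H3); apply: ler_wpM2l => //; exact: ltW.
- move=> t /HT[_ _ _ _ [_ fp]]; rewrite /N.
  have : 0 <= (2 * K' + 1) by lra.
  move=> h; have := ler_wpM2l h fp; lra.
Unshelve. all: by end_near. Qed.

End drift.

(** * Gaussian laws *)

Section normal_tails.
Context {R : realType}.
Implicit Types (c x y s : R) (U : set R).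
Local Notation mu := (@lebesgue_measure R).

Lemma normal_pdf0E s x : s != 0 ->
  normal_pdf 0 s x = normal_peak s * expR (- (x ^+ 2) / (s ^+ 2 *+ 2)).
Proof. by move=> s0; rewrite normal_pdfE// /normal_fun subr0. Qed.

Lemma normal_pdf0N s x : s != 0 -> normal_pdf 0 s (- x) = normal_pdf 0 s x.
Proof. by move=> s0; rewrite !normal_pdf0E// sqrrN. Qed.

Lemma normal_peakZ c s : 0 < c -> normal_peak (c * s) = normal_peak s / c.
Proof.
move=> c0; rewrite /normal_peak exprMn -mulrA -mulrnAr sqrtrM ?sqr_ge0//.
by rewrite sqrtr_sqr gtr0_norm// invfM mulrC.
Qed.

Lemma normal_pdf0Z c s x : 0 < c -> s != 0 ->
  normal_pdf 0 (c * s) (c * x) * c = normal_pdf 0 s x.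
Proof.
move=> c0 s0; have cn0 : c != 0 by rewrite gt_eqF.
rewrite !normal_pdf0E ?mulf_neq0// normal_peakZ//.
rewrite mulrAC divfK//; congr (_ * expR _).
by field; rewrite s0 cn0.
Qed.

Let normal_tailZ c s x : 0 < c -> s != 0 ->
  normal_prob 0 (c * s) `[c * x, +oo[ = normal_prob 0 s `[x, +oo[.
Proof.
move=> c0 s0; rewrite /normal_prob.
have dE (y : R) : is_derive y 1 ( *%R c) c.
  have := @is_deriveZ _ _ _ id c y 1 1 (is_derive_id _ _).
  by rewrite /GRing.scale/= mulr1.
have d1 : ( *%R c)^`()%classic = cst c.
  by apply/funext => y; rewrite derive1E; have [_ ->] := dE y.
rewrite (@increasing_ge0_integration_by_substitutiony R ( *%R c) (normal_pdf 0 (c * s)) x).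
- apply: eq_integral => y _; rewrite d1; congr EFin.
  by rewrite /= -[RHS](normal_pdf0Z y c0 s0).
- by move=> y z _ _ yz; rewrite ltr_pM2l.
- by rewrite d1 => y _; exact: cvg_cst.
- by rewrite d1; exact: is_cvg_cst.
- by rewrite d1; exact: is_cvg_cst.
- split; first by move=> y _; have [] := dE y.
  by apply: cvgMr; apply: cvg_at_right_filter; exact: cvg_id.
- by apply: gt0_cvgMry => //; exact: cvg_id.
- apply: continuous_subspaceT; apply: continuous_normal_pdf.
  by rewrite mulf_neq0// gt_eqF.
- by move=> y _; exact: normal_pdf_ge0.
Qed.

Let normal_tailN s x : s != 0 ->
  normal_prob 0 s `]-oo, - x] = normal_prob 0 s `[x, +oo[.
Proof.
move=> s0; rewrite /normal_prob.
rewrite (@ge0_integration_by_substitutionNy R (normal_pdf 0 s)).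
- by apply: eq_integral => y _ /=; rewrite normal_pdf0N.
- by apply: continuous_subspaceT; exact: continuous_normal_pdf.
- by move=> y _; exact: normal_pdf_ge0.
Qed.

(** Finite measures that agree on the rays [[x, +oo[] coincide, and on rays the claim is a linear
    substitution. A negative factor reverses the ray, which the symmetry of the density undoes. *)
Lemma normal_prob_scale c s U : c != 0 -> s != 0 -> measurable U ->
  normal_prob 0 s ( *%R c @^-1` U) = normal_prob 0 (`|c| * s) U.
Proof.
move=> c0 s0 mU.
have mc : measurable_fun [set: measurableTypeR R]
    ( *%R c : measurableTypeR R -> measurableTypeR R) by exact: mulrl_measurable.
pose m1 : probability (measurableTypeR R) R := distribution (normal_prob 0 s)
  (@mfun_Sub _ _ (measurableTypeR R) (measurableTypeR R) _ (mem_set mc)).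
rewrite -[LHS]/(m1 U).
have cn0 : 0 < `|c| by rewrite normr_gt0.
apply: (@measure_unique _ R (measurableTypeR R) (@RGenCInfty.G R) (fun n => `[- n%:R, +oo[%classic)) => //=.
- exact: RGenCInfty.measurableE.
- move=> _ _ [x ->] [y ->]; exists (Num.max x y).
  by apply/seteqP; split => z /=; rewrite !in_itv/= !andbT ge_max => /andP.
- by move=> n; exists (- n%:R).
- apply/seteqP; split => // x _; exists (Num.truncn `|x|).+1 => //=.
  rewrite in_itv/= andbT lerNl ltW// (le_lt_trans (ler_norm _))// normrN.
  exact: truncnS_gt.
- move=> _ [x ->]; rewrite /m1/= /distribution /pushforward/=.
  move: c0; rewrite neq_lt => /orP[cN|cp].
    have -> : *%R c @^-1` `[x, +oo[ = `]-oo, - (x / `|c|)]%classic.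
      apply/seteqP; split => z /=; rewrite !in_itv/= andbT ltr0_norm//.
        by rewrite invrN mulrN opprK ler_ndivlMr// mulrC.
      by rewrite invrN mulrN opprK ler_ndivlMr// mulrC.
    by rewrite (normal_tailN _ s0) -(normal_tailZ (x / `|c|) cn0 s0) [_ * (x / _)]mulrC divfK// gt_eqF.
  have -> : *%R c @^-1` `[x, +oo[ = `[(x / `|c|), +oo[%classic.
    by apply/seteqP; split => z /=; rewrite !in_itv/= !andbT gtr0_norm// ler_pdivrMr// mulrC.
  by rewrite -(normal_tailZ (x / `|c|) cn0 s0) [_ * (x / _)]mulrC divfK// gt_eqF.
- by move=> k; apply: (@le_lt_trans _ _ 1%E); [exact: (@probability_le1 _ _ _ m1)|exact: ltry].
Qed.

(** For [y > x >= 0], [y^2 >= x^2 + (y - x)^2]: the centred density is at most the exponential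
    factor times the density centred at [x], whose total mass is 1. *)
Lemma normal_tail_le s x : 0 < s -> 0 <= x ->
  (normal_prob 0 s `]x, +oo[ <= (expR (- (x ^+ 2) / (s ^+ 2 *+ 2)))%:E)%E.
Proof.
move=> s0 x0; have sn0 : s != 0 by rewrite gt_eqF.
set e := expR _.
apply: (@le_trans _ _ (e%:E * normal_prob x s `]x, +oo[)%E); last first.
  rewrite -[leRHS]mule1 lee_pmul2l ?lte_fin ?expR_gt0//.
  by apply: probability_le1; exact: measurable_itv.
rewrite /normal_prob -ge0_integralZl//=.
- apply: ge0_le_integral => //=.
  + by move=> y _; rewrite lee_fin normal_pdf_ge0.
  + by apply/measurable_EFinP/measurable_funTS; exact: measurable_normal_pdf.
  + apply/measurable_EFinP/measurable_funTS/measurable_funM => //.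
    exact: measurable_normal_pdf.
  + move=> y; rewrite in_itv/= andbT => xy; rewrite lee_fin !normal_pdfE//.
    rewrite mulrCA ler_wpM2l ?normal_peak_ge0// /normal_fun subr0 -expRD ler_expR.
    rewrite -mulrDl ler_wpM2r ?invr_ge0 ?mulrn_wge0 ?sqr_ge0//.
    nra.
- by apply/measurable_EFinP/measurable_funTS; exact: measurable_normal_pdf.
- by move=> y _; rewrite lee_fin normal_pdf_ge0.
- by rewrite lee_fin expR_ge0.
Qed.

(** Only the mass of []x, x + s]] is kept, with the density bounded below by its value at the right
    end. The shift by 1 in the exponent is made harmless by [gauss_exponent]. *)
Lemma normal_tail_ge s x : 0 < s -> 0 <= x ->
  ((normal_peak 1 * expR (- (x / s + 1) ^+ 2 / 2))%:E <= normal_prob 0 s `]x, +oo[)%E.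
Proof.
move=> s0 x0; have sn0 : s != 0 by rewrite gt_eqF.
set e := (X in (X%:E <= _)%E).
have -> : e%:E = (\int[mu]_(y in `]x, (x + s)%R]) (e / s)%:E)%E.
  rewrite integral_cst//= lebesgue_measure_itv/= lte_fin ltrDl s0 -EFinB.
  by rewrite -EFinM addrAC subrr add0r divfK.
apply: (@le_trans _ _ (\int[mu]_(y in `]x, (x + s)%R]) (normal_pdf 0 s y)%:E)%E).
  apply: ge0_le_integral => //=.
  - by move=> y _; rewrite lee_fin divr_ge0 ?mulr_ge0 ?expR_ge0 ?normal_peak_ge0// ltW.
  - by apply/measurable_EFinP/measurable_funTS; exact: measurable_normal_pdf.
  - move=> y; rewrite in_itv/= => /andP[xy yxs].
    rewrite lee_fin normal_pdf0E// /e mulrAC -normal_peakZ// mulr1.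
    rewrite ler_wpM2l ?normal_peak_ge0// ler_expR.
    have -> : - (x / s + 1) ^+ 2 / 2 = - (x + s) ^+ 2 / (s ^+ 2 *+ 2).
      by field.
    rewrite ler_wpM2r ?invr_ge0 ?mulrn_wge0 ?sqr_ge0// lerN2.
    nra.
apply: ge0_subset_integral => //=.
- by apply/measurable_EFinP/measurable_funTS; exact: measurable_normal_pdf.
- by move=> y _; rewrite lee_fin normal_pdf_ge0.
- by move=> y /=; rewrite !in_itv/= andbT => /andP[].
Qed.

Lemma normal_half s : 0 < s -> ((2^-1)%:E <= normal_prob 0 s `[0%R, +oo[)%E.
Proof.
move=> s0; have sn0 : s != 0 by rewrite gt_eqF.
have := @ge0_symfun_integralT R (normal_pdf 0 s) (normal_pdf_ge0 0 s)
  (@continuous_normal_pdf R 0 s sn0).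
rewrite integral_normal_pdf => /(_ (fun x => esym (normal_pdf0N x sn0))).
rewrite -set_itvcy -/(normal_prob 0 s `[0%R, +oo[) => H.
have : (2%:E * normal_prob 0 s `[0%R, +oo[ = 1)%E by rewrite -H.
have : normal_prob 0 s `[0%R, +oo[ \is a fin_num by exact: fin_num_measure.
by case: (normal_prob _ _ _) => // r _; rewrite -EFinM => -[] ?; rewrite lee_fin; lra.
Qed.

End normal_tails.

(** * Filtrations and conditional laws of Brownian increments *)

Section filtration.
Context {R : realType} {d : measure_display} {T : measurableType d}
  (P : probability T R) (F : R -> set_system T).
Hypothesis hF : usual_conditions P F.
Implicit Types (s t u v : R) (X Y : T -> R) (A : set T) (U : set R).

Definition measurable_at t Y := forall U, measurable U -> F t (Y @^-1` U).

Lemma filtration_measurable t A : 0 <= t -> F t A -> measurable A.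
Proof. by move=> t0; exact: (uc_measurable hF t0). Qed.

Lemma filtrationT t : 0 <= t -> F t setT.
Proof.
move=> t0; have [F0 FD _] := uc_sigma_algebra hF t0.
by rewrite -(setD0 setT); exact: FD.
Qed.

Lemma filtrationC t A : 0 <= t -> F t A -> F t (~` A).
Proof.
move=> t0; have [F0 FD _] := uc_sigma_algebra hF t0.
by rewrite -setTD; exact: FD.
Qed.

Let FE t : 0 <= t -> F t = <<s F t >>.
Proof. by move=> t0; apply/esym/sigma_algebra_id; exact: uc_sigma_algebra hF _ t0. Qed.

Lemma measurable_atP t Y : 0 <= t ->
  measurable_at t Y <-> measurable_fun [set: g_sigma_algebraType (F t)] Y.
Proof.
move=> t0; split => mY.
  by move=> _ U mU; rewrite setTI; apply: sub_sigma_algebra; exact: mY.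
move=> U mU; rewrite FE//; have := mY measurableT U mU.
by rewrite setTI.
Qed.

Lemma filtrationI t A A' : 0 <= t -> F t A -> F t A' -> F t (A `&` A').
Proof.
move=> t0 FA FA'; rewrite FE//.
apply: (@measurableI _ (g_sigma_algebraType (F t))); exact: sub_sigma_algebra.
Qed.

Lemma measurable_at_fun t Y : 0 <= t -> measurable_at t Y -> measurable_fun setT Y.
Proof.
move=> t0 mY _ U mU; rewrite setTI.
by apply: filtration_measurable t0 _; exact: mY.
Qed.

Lemma measurable_atS s t Y : 0 <= s -> s <= t -> measurable_at s Y -> measurable_at t Y.
Proof. by move=> s0 st mY U /mY; exact: (uc_mono hF s0 st). Qed.

Lemma measurable_atB t X Y : 0 <= t -> measurable_at t X -> measurable_at t Y ->
  measurable_at t (X \- Y).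
Proof.
by move=> t0 /(measurable_atP _ t0) mX /(measurable_atP _ t0) mY;
   apply/(measurable_atP _ t0); exact: measurable_funB.
Qed.

Lemma measurable_atZ t (c : R) X : 0 <= t -> measurable_at t X ->
  measurable_at t (fun w => c * X w).
Proof.
by move=> t0 /(measurable_atP _ t0) mX;
   apply/(measurable_atP _ t0); exact: measurable_funM.
Qed.

Lemma measurable_at_sum (I : Type) (r : seq I) t (Z : I -> T -> R) : 0 <= t ->
  (forall i, measurable_at t (Z i)) -> measurable_at t (fun w => \sum_(i <- r) Z i w).
Proof.
by move=> t0 mX; apply/(measurable_atP _ t0); apply: measurable_sum => i;
  exact/(measurable_atP _ t0).
Qed.

Lemma measurable_at_increment (X : R -> T -> R) s t : adapted F X ->
  0 <= s -> s <= t -> measurable_at t (increment X s t).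
Proof.
move=> aX s0 st; have t0 := le_trans s0 st.
apply: (@measurable_atB t (X t) (X s)) => //; first exact: aX.
exact: (measurable_atS s0 st (aX s s0)).
Qed.

End filtration.

Section pair_law.
Context {R : realType} {d : measure_display} {T : measurableType d}
  (P : probability T R).
Implicit Types (X Y : T -> R) (A : set T) (U V : set R).

Let pushforward_pair (m : {measure set T -> \bar R}) X Y :
  measurable_fun setT X -> measurable_fun setT Y ->
  exists m' : {measure set (R * R) -> \bar R},
    forall D, m' D = m ((fun w => (X w, Y w)) @^-1` D).
Proof.
move=> mX mY; have mXY := measurable_fun_pair mX mY.
pose m' := pushforward m (fun w => (X w, Y w)).
by exists (measure_function_pushforward__canonical__measure_function_Measure m mXY).
Qed.

Lemma sum_law A X Y X' Y' : measurable A ->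
  measurable_fun setT X -> measurable_fun setT Y ->
  measurable_fun setT X' -> measurable_fun setT Y' ->
  (forall U V, measurable U -> measurable V ->
     P (A `&` (X @^-1` U `&` Y @^-1` V)) =
     (P A * P (X' @^-1` U `&` Y' @^-1` V))%E) ->
  forall U, measurable U ->
    P (A `&` (X \+ Y) @^-1` U) = (P A * P ((X' \+ Y')%R @^-1` U))%E.
Proof.
move=> mA mX mY mX' mY' XYE U mU.
have [m1 m1E] := pushforward_pair (mrestr P mA) mX mY.
have [m2 m2E] := pushforward_pair P mX' mY'.
have PAfin : P A \is a fin_num by exact: fin_num_measure.
have PA0 : 0 <= fine (P A) by rewrite fine_ge0.
pose m3 := mscale (NngNum PA0) m2.
have m3E Z : m3 Z = (P A * m2 Z)%E.
  rewrite /m3 /mscale/=. by rewrite fineK.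
pose D := (fun z : R * R => z.1 + z.2) @^-1` U.
suff H : m1 D = m3 D.
  move: H; rewrite m1E m3E m2E => H.
  by rewrite (setIC A); exact: H.
apply: (@measure_unique _ R (R * R)%type
  [set U1 `*` V1 | U1 in measurable & V1 in measurable] (fun=> setT)).
- exact: measurable_prod_measurableType.
- move=> _ _ [A1 mA1 [A2 mA2 <-]] [B1 mB1 [B2 mB2 <-]].
  exists (A1 `&` B1); first exact: measurableI.
  exists (A2 `&` B2); first exact: measurableI.
  by rewrite setXI.
- by move=> _; exists setT => //; exists setT => //; rewrite setXTT.
- by rewrite bigcup_const.
- move=> _ [U1 mU1 [V1 mV1 <-]]; rewrite m1E [RHS]m3E m2E /mrestr.
  by rewrite -[LHS]/(P (_ `&` A)) setIC; exact: XYE.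
- move=> _; rewrite m1E /mrestr; apply: le_lt_trans (ltry 1).
  apply: probability_le1; rewrite preimage_setT setTI//.
- rewrite -[D]setTI.
  have : measurable_fun setT (fun z : R * R => z.1 + z.2) by exact: measurable_funD.
  exact.
Qed.

End pair_law.

Section brownian_laws.
Context {R : realType} {d : measure_display} {T : measurableType d}
  (P : probability T R) (F : R -> set_system T) (B : R -> T -> R).
Hypotheses (hF : usual_conditions P F) (hB : brownian_motion P F B).
Implicit Types (a b c s t u v : R) (X Y : T -> R) (A : set T) (U : set R).

(* The law of [increment B 0 v] stands for N(0, v), v = 0 included: the
   independence of the increments of [B] then yields N(0, u) * N(0, v) = N(0, u + v). *)
Definition bm_law v U : \bar R := P (increment B 0 v @^-1` U).

(** Law and independence of the past in one formula: given [F s], the conditional law of [Y] is the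
    deterministic N(0, v). *)
Definition has_law s Y v := forall A U, F s A -> measurable U ->
  P (A `&` Y @^-1` U) = (P A * bm_law v U)%E.

Let aB : adapted F B. Proof. exact: bm_adapted hB. Qed.

Lemma bm_lawE v U : 0 < v -> measurable U -> bm_law v U = normal_prob 0 (Num.sqrt v) U.
Proof. by move=> v0 mU; have := bm_gauss hB (lexx 0) v0 mU; rewrite subr0. Qed.

Let increment_id a : increment B a a = cst 0.
Proof. by apply/funext => w; rewrite /increment subrr. Qed.

Lemma has_law_cst0 s : has_law s (cst 0) 0.
Proof.
move=> A U _ _; rewrite /bm_law increment_id preimage_cst.
by case: ifP => _; rewrite ?setIT ?setI0 ?probability_setT ?mule1// measure0 mule0.
Qed.

Lemma has_law_increment c a b : 0 <= a -> a <= b ->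
  has_law a (fun w => c * increment B a b w) (c ^+ 2 * (b - a)).
Proof.
move=> a0; rewrite le_eqVlt => /predU1P[<-|ab].
  rewrite subrr mulr0 increment_id (_ : (fun w => _) = cst 0); last first.
    by apply/funext => w; rewrite /= mulr0.
  exact: has_law_cst0.
have [->|c0] := eqVneq c 0.
  rewrite expr0n/= mul0r (_ : (fun w => _) = cst 0); last first.
    by apply/funext => w; rewrite mul0r.
  exact: has_law_cst0.
move=> A U FA mU.
have ba0 : 0 < b - a by rewrite subr_gt0.
have c20 : 0 < c ^+ 2 by rewrite exprn_even_gt0.
have mcU : measurable ( *%R c @^-1` U).
  by rewrite -[X in measurable X]setTI; exact: (mulrl_measurable c).
have sqE : Num.sqrt (c ^+ 2 * (b - a)) = `|c| * Num.sqrt (b - a).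
  by rewrite sqrtrM ?sqr_ge0// sqrtr_sqr.
have sn0 : Num.sqrt (b - a) != 0 by rewrite gt_eqF// sqrtr_gt0.
rewrite (bm_lawE (mulr_gt0 c20 ba0) mU) sqE -(normal_prob_scale c0 sn0 mU).
rewrite -(bm_gauss hB a0 ab mcU).
exact: (bm_indep hB a0 ab FA mcU).
Qed.

Lemma has_law_add s t X Y u v : 0 <= s -> s <= t -> 0 <= u -> 0 <= v ->
  measurable_at F t X -> measurable_fun setT Y ->
  has_law s X u -> has_law t Y v -> has_law s (X \+ Y) (u + v).
Proof.
move=> s0 st u0 v0 mX mY lX lY A U FA mU.
have t0 := le_trans s0 st.
have uv0 : u <= u + v by rewrite lerDl.
have incr0 a b : 0 <= a -> a <= b -> measurable_at F b (increment B a b).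
  by move=> a0 ab; exact: (measurable_at_increment hF aB).
rewrite /bm_law (_ : increment B 0 (u + v) = increment B 0 u \+ increment B u (u + v)); last first.
  by apply/funext => w; rewrite /= /increment; ring.
apply: sum_law => //.
- exact: (filtration_measurable hF s0 FA).
- exact: (measurable_at_fun hF t0 mX).
- exact: (measurable_at_fun hF u0 (incr0 0 u (lexx 0) u0)).
- exact: (measurable_at_fun hF (le_trans u0 uv0) (incr0 u (u + v) u0 uv0)).
(* The event of [X] within [A] belongs to [F t], so the law of [Y] splits off before that of [X];
   the Brownian model pair is factored in the same way. *)
move=> U1 V1 mU1 mV1; rewrite setIA lY//; last first.
  apply: (filtrationI hF t0); last exact: mX.
  exact: (uc_mono hF s0 st).
rewrite lX//.
have := has_law_increment 1 u0 uv0.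
rewrite expr1n mul1r addrAC subrr add0r.
rewrite (_ : (fun w => _) = increment B u (u + v)); last first.
  by apply/funext => w; rewrite mul1r.
move=> /(_ (increment B 0 u @^-1` U1) V1) ->//; last exact: incr0.
by rewrite muleA.
Qed.

End brownian_laws.

(** * Step integrands and the law of their integrals *)

Section step_laws.
Context {R : realType}.
Implicit Types (a b e : R) (s : seq (step R)) (g : R -> R).
Local Notation mu := (@lebesgue_measure R).

Lemma Rintegral_itv_split g a e b : mu.-integrable `[a, b] (EFin \o g) ->
  a <= e -> e <= b ->
  \int[mu]_(x in `[a, b]) g x = \int[mu]_(x in `[a, e]) g x + \int[mu]_(x in `[e, b]) g x.
Proof.
move=> ig ae eb.
have := @Rintegral_itvB R g (BLeft a) (BRight b) e ig.
rewrite !bnd_simp => /(_ ae eb) H.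
rewrite -[X in _ + X]Rintegral_itv_obnd_cbnd; first by rewrite -H addrC subrK.
apply: integrableS ig => // x /=; rewrite !in_itv/= => /andP[ex ->].
by rewrite andbT (le_trans ae (ltW ex)).
Qed.

Lemma measurable_step_fun s : measurable_fun setT (step_fun s).
Proof.
by apply: measurable_sum => p; exact: measurable_funM.
Qed.

Lemma step_fun_bounded s : exists M, forall x, `|step_fun s x| <= M.
Proof.
exists (\sum_(p <- s) `|step_height p|) => x.
apply: (le_trans (ler_norm_sum _ _ _)); apply: ler_sum => p _.
rewrite normrM ler_piMr// indicE.
by case: (_ \in _); rewrite ?normr1 ?normr0.
Qed.

Lemma step_fun_sqr_integrable s a b :
  mu.-integrable `[a, b] (EFin \o (fun x => step_fun s x ^+ 2)).
Proof.
have [M HM] := step_fun_bounded s.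
apply: measurable_bounded_integrable.
- exact: measurable_itv.
- by rewrite /= lebesgue_measure_itv/=; case: ifP => _; rewrite ?ltry.
- by apply: measurable_funTS; apply: measurable_funX; exact: measurable_step_fun.
- exists (M ^+ 2); split; first exact: num_real.
  move=> N MN x _ /=; rewrite (le_trans _ (ltW MN))// normrX.
  by rewrite lerXn2r ?nnegrE// (le_trans _ (HM x)).
Qed.

End step_laws.

Section step_integral_law.
Context {R : realType} {d : measure_display} {T : measurableType d}
  (P : probability T R) (F : R -> set_system T) (B : R -> T -> R).
Hypotheses (hF : usual_conditions P F) (hB : brownian_motion P F B).
Implicit Types (a b e x : R) (s : seq (step R)) (p : step R).
Local Notation mu := (@lebesgue_measure R).

Let aB : adapted F B. Proof. exact: bm_adapted hB. Qed.

Lemma adapted_step_integral s : adapted F (step_integral B s).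
Proof.
move=> t t0; apply: (measurable_at_sum hF) => // p.
apply: (measurable_atZ hF) => //.
have /andP[l0 lr] := step_wf p.
apply: (measurable_atB hF) => //; apply: (measurable_atS hF _ _ (aB _)).
- by rewrite le_min t0 (le_trans l0).
- by rewrite ge_min lexx orbT.
- by rewrite le_min t0 (le_trans l0).
- by rewrite le_min t0 l0.
- by rewrite ge_min lexx orbT.
- by rewrite le_min t0 l0.
Qed.

Definition step_ends s := [seq step_left p | p <- s] ++ [seq step_right p | p <- s].

(** The value of the step function on []a, b]] when no breakpoint lies strictly inside: a step then
    contributes only if its interval covers all of []a, b]]. *)
Let coef s a b := \sum_(p <- s) step_height p * ((step_left p <= a) && (b <= step_right p))%:R.

Let step_fun_const s a b x : (forall x, x \in step_ends s -> x <= a \/ b <= x) ->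
  a < x <= b -> step_fun s x = coef s a b.
Proof.
move=> H /andP[ax xb]; rewrite /step_fun /coef; elim: s H => [|p s IH] H.
  by rewrite !big_nil.
rewrite !big_cons IH => [|y]; last first.
  rewrite mem_cat => /orP[|] ys; apply: H; rewrite mem_cat/= !inE ys ?orbT//.
have Hl : step_left p <= a \/ b <= step_left p.
  by apply: H; rewrite mem_cat/= inE eqxx.
have Hr : step_right p <= a \/ b <= step_right p.
  by apply: H; rewrite mem_cat/= !inE eqxx/= !orbT.
have /andP[l0 lr] := step_wf p.
congr (_ * _ + _); rewrite indicE; congr (_%:R).
rewrite mem_setE in_itv/=.
by case: Hl Hr => Hl [] Hr; congr nat_of_bool; apply/idP/idP => /andP[? ?]; apply/andP; split; lra.
Qed.

Let step_increment_const s a b : (forall x, x \in step_ends s -> x <= a \/ b <= x) ->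
  a <= b -> increment (step_integral B s) a b = fun w => coef s a b * increment B a b w.
Proof.
move=> H ab; apply/funext => w.
rewrite /increment /step_integral /coef; elim: s H => [|p s IH] H.
  by rewrite !big_nil subrr mul0r.
rewrite !big_cons mulrDl -IH => [|y]; last first.
  rewrite mem_cat => /orP[|] ys; apply: H; rewrite mem_cat/= !inE ys ?orbT//.
have Hl : step_left p <= a \/ b <= step_left p.
  by apply: H; rewrite mem_cat/= inE eqxx.
have Hr : step_right p <= a \/ b <= step_right p.
  by apply: H; rewrite mem_cat/= !inE eqxx/= !orbT.
have /andP[l0 lr] := step_wf p.
rewrite opprD addrACA; congr (_ + _).
rewrite /increment -mulrBr -mulrA; congr (_ * _).
have [la|/negbTE al0] := boolP (step_left p <= a); have [br|/negbTE br0] := boolP (b <= step_right p);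
  rewrite ?al0 ?br0 /=; try (have al : a < step_left p by rewrite ltNge al0);
  try (have rb : step_right p < b by rewrite ltNge br0).
- rewrite (min_l (le_trans la ab)) (min_l la) (min_r br) (min_r (le_trans ab br)) mul1r; ring.
- case: Hr => [ra|?]; last lra.
  by rewrite (min_l (le_trans la ab)) (min_l la) (min_l (ltW rb)) (min_l ra) mul0r subrr.
- case: Hl => [?|bl]; first lra.
  by rewrite (min_r bl) (min_r (ltW al)) (min_r br) (min_r (le_trans ab br)) mul0r; ring.
- case: Hl => [?|bl]; lra.
Qed.

Let count_lt (p q : pred R) (E : seq R) e : e \in E -> q e -> ~~ p e ->
  (forall x, p x -> q x) -> (count p E < count q E)%N.
Proof.
move=> eE qe pe pq; elim: E eE => //= x E IH; rewrite inE => /predU1P[<-|/IH lt].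
  by rewrite qe (negbTE pe) ltnS; exact: sub_count.
by rewrite -addnS leq_add//; case: (boolP (p x)) => // /pq ->.
Qed.

(* Induction on the number of breakpoints of [s] strictly between [a] and [b] *)
Lemma has_law_step_integral s a b : 0 <= a -> a <= b ->
  has_law P F B a (increment (step_integral B s) a b)
    (\int[mu]_(x in `[a, b]) step_fun s x ^+ 2).
Proof.
have [n] := ubnP (count (fun x => a < x < b) (step_ends s)).
elim: n => // n IH in a b *; rewrite ltnS => cn a0 ab.
have [/hasP[e eE /andP[ae eb]]|/hasPn noE] :=
  boolP (has (fun x => a < x < b) (step_ends s)).
  have e0 := le_trans a0 (ltW ae).
  have IH1 : has_law P F B a (increment (step_integral B s) a e)
    (\int[mu]_(x in `[a, e]) step_fun s x ^+ 2).
    apply: IH => //; last exact: ltW.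
    apply: leq_trans cn; apply: (count_lt eE); rewrite ?ae ?eb ?ltxx ?andbF//.
    by move=> x /andP[-> /lt_trans->].
  have IH2 : has_law P F B e (increment (step_integral B s) e b)
    (\int[mu]_(x in `[e, b]) step_fun s x ^+ 2).
    apply: IH => //; last exact: ltW.
    apply: leq_trans cn; apply: (count_lt eE); rewrite ?ae ?eb ?ltxx//.
    by move=> x /andP[/(lt_trans ae)-> ->].
  rewrite (Rintegral_itv_split (step_fun_sqr_integrable s a b) (ltW ae) (ltW eb)).
  rewrite (_ : increment _ a b = increment (step_integral B s) a e \+
     increment (step_integral B s) e b); last first.
    by apply/funext => w; rewrite /= /increment; ring.
  apply: (has_law_add hF hB a0 (ltW ae) _ _ _ _ IH1 IH2).
  - by apply: Rintegral_ge0 => x _; exact: sqr_ge0.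
  - by apply: Rintegral_ge0 => x _; exact: sqr_ge0.
  - exact: (measurable_at_increment hF (adapted_step_integral s) a0 (ltW ae)).
  - apply: (measurable_at_fun hF (le_trans a0 ab)).
    exact: (measurable_at_increment hF (adapted_step_integral s) e0 (ltW eb)).
have {}noE x : x \in step_ends s -> x <= a \/ b <= x.
  by move=> /noE; rewrite negb_and -!leNgt => /orP.
rewrite (step_increment_const noE ab).
suff -> : \int[mu]_(x in `[a, b]) step_fun s x ^+ 2 = coef s a b ^+ 2 * (b - a).
  exact: (has_law_increment hB _ a0 ab).
(* Steps are open on the left, so the value at [a] may differ from [coef s a b]; this null set is
   dropped. *)
rewrite -Rintegral_itv_obnd_cbnd; last first.
  apply: integrableS (step_fun_sqr_integrable s a b) => // x /=.
  by rewrite !in_itv/= => /andP[/ltW-> ->].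
rewrite (@eq_Rintegral _ _ _ _ _ (fun=> coef s a b ^+ 2)); last first.
  by move=> x; rewrite inE/= in_itv/= => axb; rewrite (step_fun_const noE axb).
rewrite Rintegral_cst//= lebesgue_measure_itv/= lte_fin.
case: ltP => [_|ba]; first by rewrite -EFinD.
by rewrite (@le_anti _ _ a b) ?ab// subrr.
Qed.

End step_integral_law.

Section bm_law_tails.
Context {R : realType} {d : measure_display} {T : measurableType d}
  (P : probability T R) (F : R -> set_system T) (B : R -> T -> R).
Hypothesis hB : brownian_motion P F B.
Implicit Types (u v x y : R).

Lemma bm_law0 (U : set R) : bm_law P B 0 U = (\1_U 0)%:E.
Proof.
rewrite /bm_law (_ : increment B 0 0 = cst 0); last first.
  by apply/funext => w; rewrite /increment subrr.
rewrite preimage_cst indicE; case: ifP => _; first exact: probability_setT.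
exact: measure0.
Qed.

(** The estimate uses an upper bound [v] in place of the variance [u], because the variances of the
    approximating step integrals are known only up to an error. At [u = 0] the law is a point mass
    at 0 and the tail is empty. *)
Lemma bm_law_tail_le u v y : 0 <= u -> u <= v -> 0 < v -> 0 < y ->
  (bm_law P B u `]y, +oo[ <= (expR (- (y ^+ 2) / (v *+ 2)))%:E)%E.
Proof.
rewrite le_eqVlt => /predU1P[<- _ v0 y0|u0 uv v0 y0].
  rewrite bm_law0 lee_fin indicE memNset ?expR_ge0//=.
  by rewrite in_itv/= andbT; apply/negP; rewrite -leNgt ltW.
have mU : measurable `]y, +oo[%classic by exact: measurable_itv.
rewrite (bm_lawE hB u0 mU).
have su0 : 0 < Num.sqrt u by rewrite sqrtr_gt0.
apply: (le_trans (normal_tail_le su0 (ltW y0))).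
rewrite lee_fin ler_expR sqr_sqrtr ?(ltW u0)// !mulNr lerN2.
rewrite ler_wpM2l ?sqr_ge0// lef_pV2 ?posrE ?pmulrn_lgt0//.
by rewrite lerMn2r/=.
Qed.

Lemma bm_law_half u y : 0 <= u -> 0 < y -> ((2^-1)%:E <= bm_law P B u `](- y)%R, +oo[)%E.
Proof.
have mU : measurable `](- y)%R, +oo[%classic by exact: measurable_itv.
rewrite le_eqVlt => /predU1P[<- y0|u0 y0].
  rewrite bm_law0 lee_fin indicE mem_set/=; first lra.
  by rewrite in_itv/= andbT oppr_lt0.
rewrite (bm_lawE hB u0 mU).
have su0 : 0 < Num.sqrt u by rewrite sqrtr_gt0.
apply: (le_trans (normal_half su0)).
apply: le_measure; rewrite ?inE//.
by move=> z /=; rewrite !in_itv/= !andbT; apply: lt_le_trans; rewrite oppr_lt0.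
Qed.

Lemma bm_law_tail_ge u v x : 0 < v -> v <= u -> 0 <= x ->
  ((normal_peak 1 * expR (- (x / Num.sqrt v + 1) ^+ 2 / 2))%:E <= bm_law P B u `]x, +oo[)%E.
Proof.
move=> v0 vu x0; have u0 := lt_le_trans v0 vu.
have mU : measurable `]x, +oo[%classic by exact: measurable_itv.
have su0 : 0 < Num.sqrt u by rewrite sqrtr_gt0.
have sv0 : 0 < Num.sqrt v by rewrite sqrtr_gt0.
rewrite (bm_lawE hB u0 mU).
apply: le_trans (normal_tail_ge su0 x0).
rewrite lee_fin ler_wpM2l ?normal_peak_ge0// ler_expR !mulNr lerN2 ler_wpM2r ?invr_ge0//.
have xu0 : 0 <= x / Num.sqrt u by rewrite divr_ge0// ltW.
have xuv : x / Num.sqrt u <= x / Num.sqrt v.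
  by rewrite ler_wpM2l// lef_pV2 ?posrE// ler_wsqrtr.
nra.
Qed.

End bm_law_tails.

(** * Passage from step integrands to [sigma] *)

Section step_variance.
Context {R : realType}.
Local Notation mu := (@lebesgue_measure R).
Variables (sigma : R -> R) (sn : nat -> seq (step R)) (s t : R).
Hypotheses (csigma : {within `[0, +oo[, continuous sigma}) (s0 : 0 <= s)
  (hsn : (\int[mu]_(x in `[0%R, t]) ((step_fun (sn n) x - sigma x) ^+ 2)%:E)%E
       @[n --> \oo] --> 0%E).

Let V := \int[mu]_(x in `[s, t]) sigma x ^+ 2.
Let Vn n := \int[mu]_(x in `[s, t]) step_fun (sn n) x ^+ 2.
Let En n := \int[mu]_(x in `[s, t]) (step_fun (sn n) x - sigma x) ^+ 2.

Let iV : mu.-integrable `[s, t] (EFin \o (fun x => sigma x ^+ 2)).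
Proof.
apply: (halfline_integrable t _ s0).
by apply: (@within_continuous_comp _ _ (fun y => y ^+ 2)) => //; exact: sqr_continuous.
Qed.

Let mI : @measurable _ (measurableTypeR R) `[s, t]%classic.
Proof. exact: measurable_itv. Qed.

Let iE n : mu.-integrable `[s, t] (EFin \o (fun x => (step_fun (sn n) x - sigma x) ^+ 2)).
Proof.
have [M HM] := step_fun_bounded (sn n).
have ms : measurable_fun `[s, t]%classic sigma.
  by have /integrableP[/measurable_EFinP] := halfline_integrable t csigma s0.
have ist := step_fun_sqr_integrable (sn n) s t.
have i4 : mu.-integrable `[s, t] (EFin \o (fun x => 2 * (step_fun (sn n) x ^+ 2 + sigma x ^+ 2))).
  have := integrableZl mI 2 (integrableD mI ist iV).
  by apply: eq_integrable => //; exact: measurable_itv.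
apply: le_integrable i4; first exact: measurable_itv.
  apply/measurable_EFinP/measurable_funX/measurable_funB => //.
  by apply: measurable_funTS; exact: measurable_step_fun.
move=> x _ /=; rewrite lee_fin !ger0_norm ?sqr_ge0//; last first.
  by rewrite mulr_ge0// addr_ge0// sqr_ge0.
move: (step_fun _ _) (sigma x) => a b; have := sqr_ge0 (a + b); nra.
Qed.

Let En_small (e : R) : 0 < e -> \forall n \near \oo, En n <= e.
Proof.
move=> e0; have e0' : (0 < e%:E)%E by rewrite lte_fin.
have : \forall n \near \oo, (\int[mu]_(x in `[0%R, t]) ((step_fun (sn n) x - sigma x) ^+ 2)%:E < e%:E)%E.
  have H : nbhs (0%E : \bar R) [set z | (z < e%:E)%E].
    by apply: open_nbhs_nbhs; split => //; exact: open_ereal_lt_ereal.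
  exact: (hsn H).
apply: filterS => n Hn.
have : ((En n)%:E < e%:E)%E.
  apply: le_lt_trans Hn; rewrite /En /Rintegral fineK; last first.
    exact: (integrable_fin_num mI (iE n)).
  apply: ge0_subset_integral => //=.
  - apply/measurable_EFinP/measurable_funX/measurable_funB.
      by apply: measurable_funTS; exact: measurable_step_fun.
    by have /integrableP[/measurable_EFinP] := halfline_integrable t csigma (lexx 0).
  - by move=> x _; rewrite lee_fin sqr_ge0.
  - by move=> x /=; rewrite !in_itv/= => /andP[sx ->]; rewrite (le_trans s0 sx).
by rewrite lte_fin => /ltW.
Qed.

Let le_combine (f g h : R -> R) a b : 
  mu.-integrable `[s, t] (EFin \o f) -> mu.-integrable `[s, t] (EFin \o g) ->
  mu.-integrable `[s, t] (EFin \o h) ->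
  (forall x, f x <= a * g x + b * h x) ->
  \int[mu]_(x in `[s, t]) f x <=
  a * \int[mu]_(x in `[s, t]) g x + b * \int[mu]_(x in `[s, t]) h x.
Proof.
move=> if_ ig ih fgh.
have iag := integrableZl mI a ig; have ibh := integrableZl mI b ih.
have ia : mu.-integrable `[s, t] (EFin \o (fun x => a * g x)).
  by apply: eq_integrable iag.
have ib : mu.-integrable `[s, t] (EFin \o (fun x => b * h x)).
  by apply: eq_integrable ibh.
rewrite -(RintegralZl a mI ig) -(RintegralZl b mI ih) -(RintegralD mI ia ib).
apply: le_Rintegral => //.
by have := integrableD mI ia ib; apply: eq_integrable.
Qed.

(** Young's inequality with weight [e]; the defect is a perfect square. It compares squared [L^2]
    norms directly, with a factor as close to 1 as desired. *)
Lemma sqr_le_weighted (a b e : R) : 0 < e ->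
  a ^+ 2 <= (1 + e) * b ^+ 2 + (1 + e^-1) * (a - b) ^+ 2.
Proof.
move=> e0; rewrite -subr_ge0.
have -> : (1 + e) * b ^+ 2 + (1 + e^-1) * (a - b) ^+ 2 - a ^+ 2 =
   e^-1 * (e * b - (a - b)) ^+ 2 by field; rewrite gt_eqF.
by rewrite mulr_ge0 ?sqr_ge0// invr_ge0 ltW.
Qed.

Lemma step_variance_le (v : R) : V < v -> \forall n \near \oo, Vn n <= v.
Proof.
move=> Vv; have V0 : 0 <= V by apply: Rintegral_ge0 => x _; exact: sqr_ge0.
pose e := (v - V) / (2 * (V + 1)).
have e0 : 0 < e by rewrite /e divr_gt0// ?mulr_gt0//; lra.
have c0 : 0 < 1 + e^-1 by rewrite addr_gt0// invr_gt0.
have := @En_small ((v - V) / 2 / (1 + e^-1)).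
rewrite !divr_gt0 ?subr_gt0// => /(_ isT); apply: filterS => n.
rewrite ler_pdivlMr// mulrC => HE.
have := @le_combine _ _ _ (1 + e) (1 + e^-1) (step_fun_sqr_integrable (sn n) s t) iV (iE n)
  (fun x => sqr_le_weighted _ _ e0).
rewrite -/(Vn n) -/V -/(En n) => H.
have : e * V <= (v - V) / 2.
  rewrite /e mulrAC ler_pdivrMr; last by rewrite mulr_gt0//; lra.
  nra.
lra.
Qed.

Lemma step_variance_ge (v : R) : v < V -> \forall n \near \oo, v <= Vn n.
Proof.
move=> vV.
(* The weight and the [L^2] error each use a third of the gap, and the last third gives the
   contradiction. The absolute value is there because [v] may be negative. *)
pose e := (V - v) / (3 * (`|v| + 1)).
have v1 : 0 < `|v| + 1 by rewrite ltr_wpDl.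
have e0 : 0 < e by rewrite /e divr_gt0// ?mulr_gt0// subr_gt0.
have c0 : 0 < 1 + e^-1 by rewrite addr_gt0// invr_gt0.
have := @En_small ((V - v) / 3 / (1 + e^-1)).
rewrite !divr_gt0 ?subr_gt0// => /(_ isT); apply: filterS => n.
rewrite ler_pdivlMr// mulrC => HE.
rewrite leNgt; apply/negP => Vnv.
have := @le_combine _ _ _ (1 + e) (1 + e^-1) iV (step_fun_sqr_integrable (sn n) s t) (iE n).
rewrite -/(Vn n) -/V -/(En n) => H.
have {}H : V <= (1 + e) * Vn n + (1 + e^-1) * En n.
  apply: H => x; rewrite -[(step_fun (sn n) x - sigma x) ^+ 2]sqrrN opprB.
  exact: sqr_le_weighted.
have : e * v <= (V - v) / 3.
  rewrite /e mulrAC ler_pdivrMr ?mulr_gt0//.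
  have -> : (V - v) / 3 * (3 * (`|v| + 1)) = (V - v) * (`|v| + 1) by field.
  rewrite ler_wpM2l ?subr_ge0 ?(ltW vV)//; have := ler_norm v; lra.
have : e * Vn n <= e * v by rewrite ler_wpM2l// ltW.
lra.
Qed.

End step_variance.

Section gaussian_increments.
Context {R : realType} {d : measure_display} {T : measurableType d}
  (P : probability T R) (F : R -> set_system T) (sigma : R -> R) (B I : R -> T -> R).
Hypotheses (hF : usual_conditions P F) (hB : brownian_motion P F B)
  (csigma : {within `[0, +oo[, continuous sigma})
  (hI : wiener_integral P F B sigma I).
Implicit Types (s t u v x y : R) (A : set T).
Local Notation mu := (@lebesgue_measure R).

Lemma measurable_norm_ge (Y : T -> R) (e : R) : measurable_fun setT Y ->
  measurable [set w | e <= `|Y w|].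
Proof.
move=> mY; have : measurable_fun setT (fun w => `|Y w|) by exact: measurableT_comp.
move=> /(_ measurableT `[e, +oo[%classic (measurable_itv _)); rewrite setTI.
by congr measurable; apply/seteqP; split => w /=; rewrite in_itv/= andbT.
Qed.

Lemma square_tail (Y : T -> R) (e : R) : measurable_fun setT Y -> 0 < e ->
  ((e ^+ 2)%:E * P [set w | (e <= `|Y w|)%R] <= 'E_P[fun w => (Y w ^+ 2)%R])%E.
Proof.
move=> mY e0.
have mD : measurable [set w | e <= `|Y w|].
  exact: measurable_norm_ge.
have mY2 : measurable_fun setT (fun w => (Y w ^+ 2)%:E).
  by apply/measurable_EFinP; exact: measurable_funX.
rewrite unlock -(integral_cst P mD).
apply: (@le_trans _ _ (\int[P]_(w in [set w | (e <= `|Y w|)%R]) (Y w ^+ 2)%:E)%E).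
  apply: ge0_le_integral => //=.
  - by move=> w _; rewrite lee_fin sqr_ge0.
  - exact: measurable_funTS.
  - by move=> w /= eY; rewrite lee_fin -[leRHS]real_normK ?num_real// lerXn2r ?nnegrE// ltW.
apply: ge0_subset_integral => //=.
by move=> w _; rewrite lee_fin sqr_ge0.
Qed.

Let aI : adapted F I. Proof. exact: wi_adapted hI. Qed.

Let V s t := \int[mu]_(x in `[s, t]) sigma x ^+ 2.

(** [wi_limit] on [[0, t]] provides one sequence that works at [s] and at [t], so the increments are
    close in probability by Chebyshev's inequality at both ends, each with half of [e] and half of
    [r]. *)
Let wi_approx s t : 0 <= s -> s <= t -> exists sn : nat -> seq (step R),
  (\int[mu]_(x in `[0%R, t]) ((step_fun (sn n) x - sigma x) ^+ 2)%:E)%E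
       @[n --> \oo] --> 0%E /\
  forall e r : R, 0 < e -> 0 < r -> \forall n \near \oo,
    (P [set w | (e <= `|increment I s t w - increment (step_integral B (sn n)) s t w|)%R] <= r%:E)%E.
Proof.
move=> s0 st; have t0 := le_trans s0 st.
have [sn [h1 h2]] := wi_limit hI t0; exists sn; split => // e r e0 r0.
have e2 : 0 < e / 2 by lra.
have aJ n := adapted_step_integral hF hB (sn n).
have mD u n : 0 <= u -> measurable_fun setT (fun w => I u w - step_integral B (sn n) u w).
  move=> u0; apply: (measurable_at_fun hF u0).
  by apply: (measurable_atB hF u0); [exact: aI|exact: aJ].
pose D u n := [set w | e / 2 <= `|I u w - step_integral B (sn n) u w|].
have mDD u n : 0 <= u -> measurable (D u n).
  by move=> u0; apply: measurable_norm_ge; exact: mD.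
have small u : 0 <= u -> u <= t -> \forall n \near \oo, (P (D u n) <= (r / 2)%:E)%E.
  move=> u0 ut; have := h2 u u0 ut => Hu.
  have H : nbhs (0%E : \bar R) [set z | (z < ((e / 2) ^+ 2 * (r / 2))%:E)%E].
    apply: open_nbhs_nbhs; split; first exact: open_ereal_lt_ereal.
    by rewrite /= lte_fin mulr_gt0 ?exprn_gt0//; lra.
  have : \forall n \near \oo, ('E_P[fun w => ((I u w - step_integral B (sn n) u w) ^+ 2)%R] <
      ((e / 2) ^+ 2 * (r / 2))%:E)%E by exact: (Hu _ H).
  apply: filterS => n Hn.
  have e20 : 0 < (e / 2) ^+ 2 by rewrite exprn_gt0.
  rewrite -(@lee_pmul2l _ ((e / 2) ^+ 2)%:E) ?lte_fin//.
  by rewrite -EFinM; exact: (le_trans (square_tail (mD u n u0) e2) (ltW Hn)).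
have := small s s0 st; have := small t t0 (lexx t).
apply: filterS2 => n Ht Hs.
have -> : r%:E = ((r / 2)%:E + (r / 2)%:E)%E by rewrite -EFinD; congr EFin; lra.
apply: le_trans (leeD Ht Hs).
apply: le_trans (measureU2 _ (mDD t n t0) (mDD s n s0)).
apply: le_measure; rewrite ?inE.
- apply: measurable_norm_ge; apply: (measurable_at_fun hF t0).
  apply: (measurable_atB hF t0); first exact: (measurable_at_increment hF aI s0 st).
  exact: (measurable_at_increment hF (aJ n) s0 st).
- by apply: measurableU; exact: mDD.
- move=> w /= He; apply/orP; rewrite -[_ || _]negbK negb_or -!ltNge.
  apply/negP => /andP[H1 H2].
  move: He; rewrite leNgt => /negP; apply.
  rewrite (_ : increment _ _ _ _ - _ =
     (I t w - step_integral B (sn n) t w) - (I s w - step_integral B (sn n) s w)).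
    by apply: (le_lt_trans (ler_normB _ _)); lra.
  by rewrite /increment; ring.
Qed.

Let mray x (Y : T -> R) : measurable_fun setT Y -> measurable (Y @^-1` `]x, +oo[).
Proof.
by move=> mY; rewrite -[X in measurable X]setTI; apply: mY => //; exact: measurable_itv.
Qed.

Let compare (Y Z : T -> R) A x y : measurable A -> measurable_fun setT Y -> measurable_fun setT Z ->
  x < y -> (P (A `&` Z @^-1` `]y, +oo[) <=
   P (A `&` Y @^-1` `]x, +oo[) + P [set w | (y - x <= `|Y w - Z w|)%R])%E.
Proof.
move=> mA mY mZ xy.
have mD : measurable [set w | (y - x <= `|Y w - Z w|)%R].
  by apply: measurable_norm_ge; exact: measurable_funB.
apply: le_trans (measureU2 _ _ mD); last by apply: measurableI => //; exact: mray.
apply: le_measure; rewrite ?inE.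
- by apply: measurableI => //; exact: mray.
- by apply: measurableU => //; apply: measurableI => //; exact: mray.
- move=> w /= [Aw]; rewrite in_itv/= andbT => yZ.
  have [xY|Yx] := ltP x (Y w); first by left; split => //; rewrite in_itv/= andbT.
  by right; rewrite ler_normr; apply/orP; right; lra.
Qed.

Let D s t (s_ : seq (step R)) w : R :=
  increment I s t w - increment (step_integral B s_) s t w.

Let Vn s t (sn : nat -> seq (step R)) n : R := \int[mu]_(x in `[s, t]) step_fun (sn n) x ^+ 2.

(** The gap between [x] and [y] absorbs the error of approximation in probability, the gap between
    [a] and [b] that in the variance. The remaining probability [r] is arbitrary and disappears. *)
Lemma wiener_increment_ge s t A x y (q a b : R) : 0 <= s -> s <= t -> F s A -> x < y ->
  a < V s t < b ->
  (forall u, 0 <= u -> a <= u <= b -> (q%:E <= bm_law P B u `]y, +oo[)%E) ->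
  (P A * q%:E <= P (A `&` increment I s t @^-1` `]x, +oo[))%E.
Proof.
move=> s0 st FA xy /andP[aV Vb] Hq; have t0 := le_trans s0 st.
have [sn [h1 h2]] := wi_approx s0 st.
apply/lee_addgt0Pr => r r0.
have yx : 0 < y - x by rewrite subr_gt0.
have N1 := h2 _ _ yx r0.
have N2 := step_variance_ge csigma s0 h1 aV.
have N3 := step_variance_le csigma s0 h1 Vb.
have [n [Hn1 Hn2 Hn3]] : exists n,
    [/\ (P [set w | (y - x <= `|D s t (sn n) w|)%R] <= r%:E)%E,
        a <= Vn s t sn n & Vn s t sn n <= b].
  have [n [[? ?] ?]] := filter_ex (filterI (filterI N1 N2) N3).
  by exists n.
have mA := filtration_measurable hF s0 FA.
have mJ : measurable_fun setT (increment (step_integral B (sn n)) s t).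
  apply: (measurable_at_fun hF t0).
  exact: (measurable_at_increment hF (adapted_step_integral hF hB (sn n))).
have mI : measurable_fun setT (increment I s t).
  by apply: (measurable_at_fun hF t0); exact: (measurable_at_increment hF aI).
apply: le_trans (leeD (lexx _) Hn1).
apply: le_trans (compare mA mI mJ xy).
rewrite (has_law_step_integral hF hB (sn n) s0 st FA (measurable_itv _)).
apply: lee_wpmul2l => //; apply: Hq; last by rewrite Hn2.
by apply: Rintegral_ge0 => z _; exact: sqr_ge0.
Qed.

Lemma wiener_increment_le s t x y (q a b : R) : 0 <= s -> s <= t -> y < x ->
  a < V s t < b ->
  (forall u, 0 <= u -> a <= u <= b -> (bm_law P B u `]y, +oo[ <= q%:E)%E) ->
  (P (increment I s t @^-1` `]x, +oo[) <= q%:E)%E.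
Proof.
move=> s0 st yx /andP[aV Vb] Hq; have t0 := le_trans s0 st.
have [sn [h1 h2]] := wi_approx s0 st.
apply/lee_addgt0Pr => r r0.
have xy : 0 < x - y by rewrite subr_gt0.
have N1 := h2 _ _ xy r0.
have N2 := step_variance_ge csigma s0 h1 aV.
have N3 := step_variance_le csigma s0 h1 Vb.
have [n [Hn1 Hn2 Hn3]] : exists n,
    [/\ (P [set w | (x - y <= `|D s t (sn n) w|)%R] <= r%:E)%E,
        a <= Vn s t sn n & Vn s t sn n <= b].
  have [n [[? ?] ?]] := filter_ex (filterI (filterI N1 N2) N3).
  by exists n.
have mJ : measurable_fun setT (increment (step_integral B (sn n)) s t).
  apply: (measurable_at_fun hF t0).
  exact: (measurable_at_increment hF (adapted_step_integral hF hB (sn n))).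
have mI : measurable_fun setT (increment I s t).
  by apply: (measurable_at_fun hF t0); exact: (measurable_at_increment hF aI).
rewrite -[X in P X]setTI.
apply: (le_trans (compare measurableT mJ mI yx)).
apply: leeD; last first.
  rewrite (_ : [set w | _] = [set w | (x - y <= `|D s t (sn n) w|)%R])//.
  by apply/funext => w /=; rewrite distrC.
rewrite (has_law_step_integral hF hB (sn n) s0 st (filtrationT hF s0) (measurable_itv _)).
rewrite probability_setT mul1e; apply: Hq; last by rewrite Hn2.
by apply: Rintegral_ge0 => z _; exact: sqr_ge0.
Qed.

End gaussian_increments.

(** * The law of the iterated logarithm *)

Section levy_inequality.
Context {R : realType} {d : measure_display} {T : measurableType d}
  (P : probability T R) (F : R -> set_system T) (Y : R -> T -> R).
Hypotheses (hF : usual_conditions P F) (aY : adapted F Y)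
  (half : forall (s t e : R) (A : set T), 0 <= s -> s <= t -> F s A -> 0 < e ->
     (P A * (2^-1)%:E <= P (A `&` increment Y s t @^-1` `](- e)%R, +oo[))%E).
Implicit Types (s t a e : R) (A : set T) (w : T).

Let exceeds a t := increment Y 0 t @^-1` `]a, +oo[%classic.

Let F_exceeds a t : 0 <= t -> F t (exceeds a t).
Proof.
move=> t0; have := measurable_at_increment hF aY (lexx 0) t0.
by apply; exact: measurable_itv.
Qed.

Let F_union a (tt : nat -> R) n s : 0 <= s -> (forall k, (k < n)%N -> 0 <= tt k <= s) ->
  F s (\big[setU/set0]_(k < n) exceeds a (tt k)).
Proof.
move=> s0 tn; elim: n tn => [|n IH] tn.
  rewrite big_ord0 -(setCK set0) setC0; apply: (filtrationC hF s0).
  exact: (filtrationT hF s0).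
rewrite big_ord_recr/= -[X in F s X]setCK setCU; apply: (filtrationC hF s0).
apply: (filtrationI hF s0); apply: (filtrationC hF s0).
  by apply: IH => k kn; apply: tn; rewrite ltnW.
have /andP[t0 ts] := tn n (ltnSn n).
by apply: (uc_mono hF t0 ts); exact: F_exceeds.
Qed.

(* Levy's argument: at the first exceedance time the increment up to [t] is at
   least [- e] with conditional probability one half. *)
Let levy_grid a e (tt : nat -> R) n t : 0 < e ->
  (forall j k, (j <= k)%N -> tt j <= tt k) -> (forall k, (k < n)%N -> 0 <= tt k <= t) ->
  0 <= t ->
  (P (\big[setU/set0]_(k < n) exceeds a (tt k)) * (2^-1)%:E <=
     P ((\big[setU/set0]_(k < n) exceeds a (tt k)) `&` exceeds (a - e) t))%E.
Proof.
move=> e0 tt_homo tn t0; elim: n tn => [|n IH] tn.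
  by rewrite big_ord0 measure0 mul0e measure_ge0.
rewrite big_ord_recr/=; set E := \big[setU/set0]_(k < n) _.
have /andP[tn0 tnt] := tn n (ltnSn n).
have tnk k : (k < n)%N -> 0 <= tt k <= tt n.
  move=> kn; have /andP[-> _] := tn k (ltnW kn).
  by rewrite tt_homo// ltnW.
have FE : F (tt n) E by exact: F_union.
pose A := exceeds a (tt n) `&` ~` E.
have FA : F (tt n) A.
  by apply: (filtrationI hF tn0); [exact: F_exceeds|exact: (filtrationC hF tn0)].
have mE := filtration_measurable hF tn0 FE.
have mA := filtration_measurable hF tn0 FA.
have mD : measurable (exceeds (a - e) t).
  exact: (filtration_measurable hF t0 (F_exceeds _ t0)).
have -> : E `|` exceeds a (tt n) = E `|` A.
  apply/seteqP; split => w [?|H]; [by left| |by left|by case: H; right].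
  by have [Ew|nEw] := pselect (E w); [left|right].
have EA0 : E `&` A = set0 by apply/seteqP; split => w // [Ew []].
rewrite measureU// setIUl measureU; last 3 first.
- exact: measurableI.
- exact: measurableI.
- by apply/seteqP; split => w // [[Ew _] [[_ nEw] _]].
rewrite ge0_muleDl ?measure_ge0//; apply: leeD.
  by apply: IH => k kn; apply: tn; rewrite ltnW.
apply: (le_trans (half tn0 tnt FA e0)).
have mI : measurable (increment Y (tt n) t @^-1` `](- e)%R, +oo[).
  apply: (filtration_measurable hF t0).
  by apply: (measurable_at_increment hF aY tn0 tnt); exact: measurable_itv.
apply: le_measure; rewrite ?inE; [exact: measurableI|exact: measurableI|].
move=> w [[Aw nE]] ; rewrite /= in_itv/= andbT => He; split => //.
move: Aw He; rewrite /exceeds /= !in_itv/= !andbT /increment; lra.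
Qed.

Let grid t N k : R := t * (k%:R / 2 ^+ N).

(** A measurable substitute for the event that the supremum over [[0, t]] of the increment from 0
    exceeds [a]. *)
Definition dyadic_exceeds a t :=
  \bigcup_N \big[setU/set0]_(k < (2 ^ N).+1) exceeds a (grid t N k).

Let grid_itv t N k : 0 <= t -> (k < (2 ^ N).+1)%N -> 0 <= grid t N k <= t.
Proof.
move=> t0 kN; rewrite /grid mulr_ge0 ?divr_ge0//=.
by rewrite ler_piMr// ler_pdivrMr ?exprn_gt0// mul1r -natrX ler_nat.
Qed.

Let measurable_grid a t N : 0 <= t ->
  measurable (\big[setU/set0]_(k < (2 ^ N).+1) exceeds a (grid t N k)).
Proof.
move=> t0; apply: (filtration_measurable hF t0).
by apply: F_union => // k; exact: grid_itv.
Qed.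

Lemma measurable_dyadic_exceeds a t : 0 <= t -> measurable (dyadic_exceeds a t).
Proof. by move=> t0; apply: bigcupT_measurable => N; exact: measurable_grid. Qed.

(** The point [k / 2^N] reappears as [2 k / 2^(N+1)], so the grid events increase with [N] and the
    inequality on finite grids passes to their union by continuity from below. *)
Lemma levy_dyadic a e t : 0 <= t -> 0 < e ->
  (P (dyadic_exceeds a t) * (2^-1)%:E <= P (increment Y 0 t @^-1` `](a - e)%R, +oo[))%E.
Proof.
move=> t0 e0.
pose G N := \big[setU/set0]_(k < (2 ^ N).+1) exceeds a (grid t N k).
have GP N : (P (G N) * (2^-1)%:E <= P (exceeds (a - e) t))%E.
  have := @levy_grid a e (grid t N) (2 ^ N).+1 t e0.
  have h1 : forall j k : nat, (j <= k)%N -> grid t N j <= grid t N k.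
    by move=> j k jk; rewrite /grid ler_wpM2l// ler_pM2r ?invr_gt0 ?exprn_gt0// ler_nat.
  have h2 : forall k : nat, (k < (2 ^ N).+1)%N -> 0 <= grid t N k <= t.
    by move=> k; exact: grid_itv.
  move=> /(_ h1 h2 t0) H; apply: (le_trans H); apply: le_measure; rewrite ?inE.
  - apply: measurableI; first exact: measurable_grid.
    exact: (filtration_measurable hF t0 (F_exceeds _ t0)).
  - exact: (filtration_measurable hF t0 (F_exceeds _ t0)).
  - by apply: subIset; right.
have ndG : nondecreasing_seq G.
  apply/nondecreasing_seqP => N; apply/subsetPset => w.
  rewrite /G -(bigcup_mkord _ (fun k => exceeds a (grid t N k))) => -[k /= kN Hk].
  rewrite -(bigcup_mkord _ (fun k => exceeds a (grid t N.+1 k))); exists (2 * k)%N.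
    by rewrite /= ltnS expnS leq_mul2l/= -ltnS.
  suff -> : grid t N.+1 (2 * k) = grid t N k by [].
  rewrite /grid; congr (_ * _); rewrite exprS natrM; field.
  by rewrite expf_neq0.
have cvg := @nondecreasing_cvg_mu _ _ _ P G (fun N => measurable_grid a N t0)
  (measurable_dyadic_exceeds a t0) ndG.
rewrite muleC -lee_pdivlMl//.
have limE := cvg_lim (@ereal_hausdorff R) cvg.
rewrite -[P (dyadic_exceeds a t)]limE; apply: lime_le.
  by apply/cvg_ex; exists (P (\bigcup_N G N)).
apply: nearW => N /=; rewrite lee_pdivlMl ?invr_gt0// muleC; exact: GP.
Qed.

(** A strict exceedance at [s] persists nearby by continuity; the grid point just below [s] is used,
    which stays in [[0, t]]. *)
Lemma dyadic_exceedsP a t w s : {within `[0, +oo[, continuous (fun t => Y t w)} ->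
  0 <= s -> s <= t -> 0 < t -> a < Y s w - Y 0 w -> dyadic_exceeds a t w.
Proof.
move=> cY s0 st t0 aYs.
have /subspace_continuousP/(_ s) := cY; rewrite /= in_itv/= andbT => /(_ s0).
have aYs' : a + Y 0 w < Y s w by rewrite -ltrBrDr.
move=> Hc; have := @cvgr_gt _ _ _ _ _ _ Hc (a + Y 0 w) aYs'.
rewrite near_withinE => -[r /= r0 Hr].
have [N HN] : exists N : nat, t / 2 ^+ N < r.
  exists (Num.truncn (t / r)).+1.
  have tr : 0 <= t / r by rewrite divr_ge0// ltW.
  rewrite ltr_pdivrMr ?exprn_gt0// mulrC -ltr_pdivrMr//.
  apply: (lt_le_trans (truncnS_gt _)).
  by rewrite -natrX ler_nat ltnW// ltn_expl.
have p2 : 0 < (2 : R) ^+ N by rewrite exprn_gt0.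
pose k := Num.truncn (s / t * 2 ^+ N).
have st0 : 0 <= s / t * 2 ^+ N by rewrite mulr_ge0 ?divr_ge0 ?exprn_ge0// ltW.
have /andP[k1 k2] := truncn_itv st0.
rewrite -/k in k1 k2.
have sE : s = t * ((s / t * 2 ^+ N) / 2 ^+ N) by field; rewrite !gt_eqF.
have ks : grid t N k <= s.
  by rewrite [leRHS]sE /grid ler_pM2l// ler_pM2r ?invr_gt0.
have sk : s < grid t N k + t / 2 ^+ N.
  rewrite [ltLHS]sE /grid -mulrDr ltr_pM2l// -[X in _ + X]mul1r -mulrDl.
  by rewrite ltr_pM2r ?invr_gt0// natr1.
exists N => //; rewrite -(bigcup_mkord _ (fun k => exceeds a (grid t N k))); exists k.
  rewrite /= ltnS -(ler_nat R) natrX; apply: (le_trans k1).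
  by rewrite ler_piMl ?(ltW p2)// ler_pdivrMr// mul1r.
rewrite /exceeds /= in_itv/= andbT /increment ltrBrDr.
apply: Hr; last by rewrite /= in_itv/= andbT /grid mulr_ge0 ?divr_ge0 ?exprn_ge0// ltW.
by rewrite /ball/= ger0_norm ?subr_ge0//; lra.
Qed.

End levy_inequality.

(** * The iterated logarithm scale and two series *)

Section loglog.
Context {R : realType}.
Implicit Types (x y c e : R).

(** [Sigma sigma t] is by definition [lil_scale (int_sqr sigma t)]; all estimates of the scale are
    made in the variance variable. *)
Definition lil_scale x := Num.sqrt (2 * x * ln (ln x)).

Lemma ln_ge1 x : expR 1 <= x -> 1 <= ln x.
Proof.
move=> ex; have x0 : 0 < x by apply: lt_le_trans ex; exact: expR_gt0.
by rewrite -(expRK 1) ler_ln ?posrE ?expR_gt0.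
Qed.

Lemma lnln_ge0 x : expR 1 <= x -> 0 <= ln (ln x).
Proof. by move=> /ln_ge1; exact: ln_ge0. Qed.

Lemma lnln_homo x y : expR 1 <= x -> x <= y -> ln (ln x) <= ln (ln y).
Proof.
move=> ex xy; have x0 : 0 < x by apply: lt_le_trans ex; exact: expR_gt0.
have y0 := lt_le_trans x0 xy.
have lxy : ln x <= ln y by rewrite ler_ln ?posrE.
have l1 := ln_ge1 ex.
by rewrite ler_ln ?posrE//; lra.
Qed.

Lemma lil_scale_sqr x : expR 1 <= x -> lil_scale x ^+ 2 = 2 * x * ln (ln x).
Proof.
move=> ex; have x0 : 0 < x by apply: lt_le_trans ex; exact: expR_gt0.
rewrite sqr_sqrtr// mulr_ge0 ?lnln_ge0// mulr_ge0// ltW//.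
Qed.

Lemma lil_scale_gt0 x : expR 1 < x -> 0 < lil_scale x.
Proof.
move=> ex; have x0 : 0 < x by apply: lt_trans ex; exact: expR_gt0.
rewrite sqrtr_gt0 mulr_gt0 ?mulr_gt0//; apply: ln_gt0.
by rewrite -(expRK 1) ltr_ln ?posrE ?expR_gt0.
Qed.

Lemma lil_scaleM c x y : 0 < c -> expR 1 <= x -> c * x <= y ->
  x <= y -> Num.sqrt c * lil_scale x <= lil_scale y.
Proof.
move=> c0 ex cxy xy; have x0 : 0 < x by apply: lt_le_trans ex; exact: expR_gt0.
rewrite -sqrtrM ?(ltW c0)// ler_wsqrtr//.
have -> : c * (2 * x * ln (ln x)) = 2 * (c * x) * ln (ln x) by ring.
apply: ler_pM; rewrite ?lnln_ge0 ?lnln_homo//; last by rewrite ler_pM2l.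
by rewrite !mulr_ge0// ltW.
Qed.

Lemma lil_scale_homo x y : expR 1 <= x -> x <= y -> lil_scale x <= lil_scale y.
Proof.
move=> ex xy; have := @lil_scaleM 1 x y ltr01 ex.
by rewrite sqrtr1 !mul1r; apply.
Qed.

Lemma lil_scale_ge M x : expR (expR 1) <= x -> M ^+ 2 <= x -> M <= lil_scale x.
Proof.
move=> ex Mx; have x0 : 0 < x by apply: lt_le_trans ex; exact: expR_gt0.
have e1 : expR 1 <= ln x by rewrite -(expRK (expR 1)) ler_ln ?posrE ?expR_gt0.
have l1 : 1 <= ln (ln x) by exact: ln_ge1.
apply: (le_trans (ler_norm M)); rewrite -sqrtr_sqr ler_wsqrtr//.
nra.
Qed.

Lemma expr_unbounded (q A : R) : 1 < q ->
  exists n0, forall n, (n0 <= n)%N -> A < q ^+ n.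
Proof.
move=> q1; have q0 : 0 < q - 1 by rewrite subr_gt0.
exists (Num.truncn (`|A| / (q - 1))).+1 => n n0n.
apply: (@lt_le_trans _ _ (n%:R * (q - 1))).
  rewrite -ltr_pdivrMr//; apply: (@le_lt_trans _ _ (`|A| / (q - 1))).
    by rewrite ler_pM2r ?invr_gt0// ler_norm.
  by apply: lt_le_trans (truncnS_gt _) _; rewrite ler_nat.
elim: n {n0n} => [|n IH]; first by rewrite mul0r expr0.
rewrite exprS -natr1 mulrDl mul1r.
have : 1 <= q ^+ n by rewrite exprn_ege1// ltW.
nra.
Qed.

(* One step of the telescoping comparison with the differences of [n ^ (- e)] *)
Lemma p_series_step e x : 0 < e -> 0 < x ->
  expR (- (1 + e) * ln (x + 1)) <= (expR (- e * ln x) - expR (- e * ln (x + 1))) / e.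
Proof.
move=> e0 x0; have x1 : 0 < x + 1 by lra.
rewrite ler_pdivlMr//.
have -> : expR (- (1 + e) * ln (x + 1)) = expR (- e * ln (x + 1)) * (x + 1)^-1.
  by rewrite -[(x + 1)^-1](@lnK R) ?posrE ?invr_gt0// lnV ?posrE// -expRD; congr expR; ring.
have -> : expR (- e * ln x) = expR (- e * ln (x + 1)) * expR (- e * ln (x / (x + 1))).
  by rewrite -expRD ln_div ?posrE//; congr expR; ring.
rewrite -[X in _ - X]mulr1 -mulrBr -mulrA ler_wpM2l ?expR_ge0//.
have := expR_ge1Dx (- e * ln (x / (x + 1))).
have : ln (x / (x + 1)) <= - (x + 1)^-1.
  have := @le_ln1Dx R (- (x + 1)^-1).
  have -> : 1 + - (x + 1)^-1 = x / (x + 1) by field; rewrite gt_eqF.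
  apply; rewrite ltrN2 invf_lt1//; lra.
nra.
Qed.

(** Powers are written through [expR] and [ln], the form in which the Gaussian tails produce them.
    In the constant, 1 is the first term and [e^-1] bounds the telescoping sum. *)
Lemma p_series_bounded e c : 0 < e -> 0 < c ->
  exists C, forall n, \sum_(k < n) expR (- (1 + e) * ln (c * k.+1%:R)) <= C.
Proof.
move=> e0 c0; exists (expR (- (1 + e) * ln c) * (1 + e^-1)) => n.
have -> : \sum_(k < n) expR (- (1 + e) * ln (c * k.+1%:R)) =
    expR (- (1 + e) * ln c) * \sum_(k < n) expR (- (1 + e) * ln k.+1%:R).
  rewrite big_distrr/=; apply: eq_bigr => k _.
  by rewrite lnM ?posrE ?ltr0n// mulrDr expRD.
rewrite ler_wpM2l ?expR_ge0//.
case: n => [|n]; first by rewrite big_ord0 addr_ge0// invr_ge0 ltW.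
suff : \sum_(k < n.+1) expR (- (1 + e) * ln k.+1%:R) <=
   1 + (1 - expR (- e * ln n.+1%:R)) / e.
  move=> /le_trans; apply; rewrite lerD2l -[leRHS]mul1r.
  by rewrite ler_pM2r ?invr_gt0// lerBlDr lerDl expR_ge0.
elim: n => [|n IH].
  by rewrite big_ord_recl big_ord0 ln1 !mulr0 expR0 subrr mul0r.
rewrite big_ord_recr/=; apply: (le_trans (lerD IH (lexx _))).
have := @p_series_step e n.+1%:R e0 (ltr0Sn _ _).
rewrite natr1 => H; apply: (le_trans (lerD (lexx _) H)).
by rewrite -addrA -mulrDl addrA subrK.
Qed.

Lemma harmonic_unbounded c M : 0 < c -> exists n, M <= \sum_(k < n) c / k.+1%:R.
Proof.
move=> c0; apply: contrapT => /forallNP H.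
apply: (@dvg_harmonic R); apply: nondecreasing_is_cvgn.
  by apply: nondecreasing_series => k _ _; exact: harmonic_ge0.
exists (M / c) => _ [n _ <-]; rewrite ler_pdivlMr// mulrC.
have /negP := H n; rewrite -ltNge => /ltW; apply: le_trans.
by rewrite /series/= big_mkord big_distrr.
Qed.

End loglog.

(** * Upper half of the law of the iterated logarithm *)

Section lil_upper.
Context {R : realType} {d : measure_display} {T : measurableType d}
  (P : probability T R) (F : R -> set_system T) (Y : R -> T -> R) (v : R -> R).
Hypotheses (hF : usual_conditions P F) (aY : adapted F Y) (cY : continuous_paths P Y)
  (half : forall (s t e : R) (A : set T), 0 <= s -> s <= t -> F s A -> 0 < e ->
     (P A * (2^-1)%:E <= P (A `&` increment Y s t @^-1` `](- e)%R, +oo[))%E)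
  (v_homo : forall s t : R, 0 <= s -> s <= t -> v s <= v t)
  (v_onto : forall c : R, 0 < c -> exists2 t, 0 <= t & v t = c).
Implicit Types (t x y : R) (w : T).

Lemma variance_cvg : v t @[t --> +oo] --> +oo.
Proof.
apply/cvgryPge => A; have A1 : 0 < `|A| + 1 by rewrite ltr_wpDl.
have [t t0 vt] := v_onto A1.
exists t; split; first exact: num_real.
move=> s /ltW ts; apply: le_trans (v_homo t0 ts).
by rewrite vt; have := ler_norm A; lra.
Qed.

Lemma lil_scale_cvg : lil_scale (v t) @[t --> +oo] --> +oo.
Proof.
apply/cvgryPge => A; near=> t; apply: lil_scale_ge; near: t.
- exact: (cvgry_ge variance_cvg).
- exact: (cvgry_ge variance_cvg).
Unshelve. all: by end_near. Qed.

(** Arbitrary preimages of [q ^+ n] will do: [v] may have flat pieces, but its values at the chosen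
    times increase strictly, which orders the times. *)
Lemma geometric_times (q : R) : 1 < q -> exists tt : nat -> R,
  [/\ forall n, 0 <= tt n, forall n, v (tt n) = q ^+ n,
      forall n, tt n < tt n.+1 & forall t, exists n, t < tt n].
Proof.
move=> q1; have q0 : 0 < q by lra.
have H n : {t | 0 <= t & v t = q ^+ n}.
  by apply: cid2; apply: v_onto; rewrite exprn_gt0.
exists (fun n => s2val (H n)); split.
- by move=> n; exact: (s2valP (H n)).
- by move=> n; exact: (s2valP' (H n)).
- move=> n; rewrite ltNge; apply/negP => /(v_homo (s2valP (H n.+1))).
  by rewrite !(s2valP' (H _)) leNgt ltr_eXn2l// ltnSn.
- move=> t; have [n /(_ n (leqnn n)) Hn] := expr_unbounded (v `|t|) q1.
  exists n; apply: (le_lt_trans (ler_norm t)); rewrite ltNge; apply/negP.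
  by move=> /(v_homo (s2valP (H n))); rewrite (s2valP' (H n)) leNgt Hn.
Qed.

Hypothesis tail_le : forall t x y b : R, 0 <= t -> 0 < y -> y < x -> v t < b ->
  (P (increment Y 0 t @^-1` `]x, +oo[) <= (expR (- (y ^+ 2) / (b *+ 2)))%:E)%E.

(** Levy's inequality uses [e / 4] of the margin, and lowering the level strictly to [1 + e / 2] the
    next quarter. The variance bound [q ^+ n.+2] costs two factors [q]: one for the length of the
    block, one for strictness. With [q = 1 + e / 4] the ratio [(1 + e / 2) / q] still exceeds 1, so
    the bounds are summable in [n]. *)
Let exceeds_bound (q e c : R) (tt : nat -> R) n : 1 < q -> 0 < e -> e / 4 = q - 1 ->
  (forall n, 0 <= tt n) -> (forall n, v (tt n) = q ^+ n) -> expR 1 < q ^+ n ->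
  (P (dyadic_exceeds Y ((1 + e) * lil_scale (q ^+ n)) (tt n.+1)) <=
   (2 * expR (- ((1 + e / 2) / q) ^+ 2 * ln (ln (q ^+ n))))%:E)%E.
Proof.
move=> q1 e0 eq tt0 vtt qn; have q0 : 0 < q by lra.
have S0 := lil_scale_gt0 qn; set S := lil_scale (q ^+ n) in S0 *.
have e40 : 0 < e / 4 * S by rewrite mulr_gt0//; lra.
have := levy_dyadic hF aY half ((1 + e) * S) (tt0 n.+1) e40.
have y0 : 0 < (1 + e / 2) * S by rewrite mulr_gt0//; lra.
have yx : (1 + e / 2) * S < (1 + e) * S - e / 4 * S.
  by rewrite -mulrBl ltr_pM2r//; lra.
have vb : v (tt n.+1) < q ^+ n.+2 by rewrite vtt ltr_eXn2l.
have := tail_le (tt0 n.+1) y0 yx vb => H1 H2.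
have := le_trans H2 H1; rewrite muleC -lee_pdivlMl// invrK -EFinM => H3.
apply: (le_trans H3); rewrite lee_fin ler_pM2l// ler_expR.
rewrite exprMn (lil_scale_sqr (ltW qn)).
suff -> : - ((1 + e / 2) ^+ 2 * (2 * q ^+ n * ln (ln (q ^+ n)))) / (q ^+ n.+2 *+ 2) =
   - ((1 + e / 2) / q) ^+ 2 * ln (ln (q ^+ n)) by [].
have qn0 : q ^+ n != 0 by rewrite expf_neq0// gt_eqF.
by rewrite !exprS; field; rewrite qn0 gt_eqF.
Qed.

Theorem lil_upper (e : R) : 0 < e ->
  {ae P, forall w, \forall t \near +oo, Y t w <= (1 + e) * lil_scale (v t)}.
Proof.
(* The other half of [e] absorbs the initial value [Y 0 w], as the exceedance events only concern
   increments from time 0. *)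
move=> e0; pose e' := e / 2; have e'0 : 0 < e' by rewrite /e'; lra.
pose q := 1 + e' / 4; have q1 : 1 < q by rewrite /q; lra.
have q0 : 0 < q by lra.
have [tt [tt0 vtt ttS ttoo]] := geometric_times q1.
have [n0 Hn0] := expr_unbounded (expR 1) q1.
pose a := (1 + e' / 2) / q.
have a1 : 1 < a ^+ 2.
  rewrite exprn_egt1// /a ltr_pdivlMr// mul1r /q; lra.
have c0 : 0 < ln q by exact: ln_gt0.
(* The level belongs to the start of the block and the time horizon to its end. The shift [n0]
   ensures [expR 1 < q ^+ n], where the scale is positive and monotone. *)
pose E k := dyadic_exceeds Y ((1 + e') * lil_scale (q ^+ (k + n0))) (tt (k + n0).+1).
have mE k : measurable (E k) by exact: (measurable_dyadic_exceeds hF aY).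
have PE k : (P (E k) <= (2 * expR (- (1 + (a ^+ 2 - 1)) * ln (ln q * k.+1%:R)))%:E)%E.
  have eq' : e' / 4 = q - 1 by rewrite /q; lra.
  have qk : expR 1 < q ^+ (k + n0) by apply: Hn0; rewrite leq_addl.
  apply: (le_trans (exceeds_bound 0 q1 e'0 eq' tt0 vtt qk)).
  rewrite lee_fin ler_pM2l// ler_expR -/a addrC subrK !mulNr lerN2.
  rewrite ler_wpM2l ?sqr_ge0// lnXn// -[ln q *+ _]mulr_natr.
  have n0_gt0 : (0 < n0)%N.
    rewrite lt0n; apply/eqP => n00; have := Hn0 0%N.
    by rewrite n00 expr0 => /(_ isT); have := @expR_ge1Dx R 1; lra.
  rewrite ler_ln ?posrE ?mulr_gt0 ?ltr0n ?addn_gt0 ?n0_gt0 ?orbT//.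
  by rewrite ler_pM2l// ler_nat -addn1 leq_add2l.
have a10 : 0 < a ^+ 2 - 1 by lra.
have [C HC] := p_series_bounded a10 c0.
have sumE : (\sum_(k <oo) P (E k) < +oo)%E.
  apply: (@le_lt_trans _ _ (2 * C)%:E); last exact: ltry.
  apply: lime_le; first by apply: is_cvg_nneseries => k _ _; exact: measure_ge0.
  apply: nearW => n; rewrite big_mkord.
  apply: (@le_trans _ _ (\sum_(k < n) (2 * expR (- (1 + (a ^+ 2 - 1)) * ln (ln q * k.+1%:R)))%:E)%E).
    by apply: lee_sum => k _; exact: PE.
  by rewrite sumEFin lee_fin -big_distrr/= ler_pM2l//; exact: HC.
have BC := lim_sup_set_cvg0 mE sumE.
have mlim : measurable (lim_sup_set E).
  by apply: bigcapT_measurable => n; apply: bigcup_measurable => k _; exact: mE.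
have neg : P.-negligible (lim_sup_set E) by apply/negligibleP.
apply: filterS2 cY (_ : {ae P, forall w, ~ lim_sup_set E w}); last first.
  by apply: negligibleS neg => w /= /contrapT.
move=> w cYw nE.
have [m Hm] : exists m, forall k, (m <= k)%N -> ~ E k w.
  apply: contrapT => /forallNP H; apply: nE => n _.
  by have /existsNP[k /not_implyP[nk /contrapT Ek]] := H n; exists k.
have bnd : forall t, tt (m + n0) < t -> Y t w - Y 0 w <= (1 + e') * lil_scale (v t).
  move=> t Nt.
  (* The least such index locates the block containing [t]; it is not 0, because [t] lies beyond
     [tt (m + n0)]. *)
  have ex : exists n, t < tt n by exact: ttoo.
  have [] := ex_minnP ex => -[|n] tn nmin.
    have := lt_trans Nt tn.
    have : forall j, tt 0%N <= tt j by elim => // j /le_trans; apply; rewrite ltW.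
    by move=> /(_ (m + n0)%N) /le_lt_trans /[apply]; rewrite ltxx.
  have ttn : tt n <= t.
    by rewrite leNgt; apply/negP => /nmin; rewrite ltnn.
  have tt_homo : forall i j, (i <= j)%N -> tt i <= tt j.
    move=> i; elim => [|j IH]; first by rewrite leqn0 => /eqP->.
    by rewrite leq_eqVlt => /predU1P[->//|/IH /le_trans]; apply; rewrite ltW.
  have Nn : (m + n0 <= n)%N.
    rewrite leqNgt; apply/negP => /tt_homo ttnN.
    by have := lt_le_trans Nt (le_trans (ltW tn) ttnN); rewrite ltxx.
  have n0n : (n0 <= n)%N by apply: leq_trans Nn; rewrite leq_addl.
  have t_ge0 : 0 <= t by exact: le_trans (tt0 n) ttn.
  have t_gt0 : 0 < tt n.+1 by exact: le_lt_trans t_ge0 tn.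
  rewrite leNgt; apply/negP => Yt; apply: (Hm (n - n0)%N); first by rewrite leq_subRL// addnC.
  rewrite /E subnK//; apply: (@dyadic_exceedsP _ _ _ _ _ _ _ t) => //; first exact: ltW.
  apply: le_lt_trans Yt; rewrite ler_pM2l; last lra.
  apply: lil_scale_homo; first exact/ltW/Hn0.
  by rewrite -vtt v_homo.
near=> t.
have Yt : Y t w - Y 0 w <= (1 + e') * lil_scale (v t).
  by apply: bnd; near: t; exact: nbhs_pinfty_gt (num_real _).
have Y0 : Y 0 w / e' <= lil_scale (v t).
  by near: t; exact: (cvgry_ge lil_scale_cvg).
move: Y0; rewrite ler_pdivrMr// => Y0.
have -> : e = e' + e' by rewrite /e'; lra.
by move: (lil_scale _) (Y t w) Yt Y0 => S Z; lra.
Unshelve. all: by end_near. Qed.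

End lil_upper.

(** * Lower half of the law of the iterated logarithm *)

Section lil_lower.
Context {R : realType} {d : measure_display} {T : measurableType d}
  (P : probability T R) (F : R -> set_system T) (Y : R -> T -> R) (v : R -> R).
Hypotheses (hF : usual_conditions P F) (aY : adapted F Y)
  (v_homo : forall s t : R, 0 <= s -> s <= t -> v s <= v t)
  (v_onto : forall c : R, 0 < c -> exists2 t, 0 <= t & v t = c)
  (tail_ge : forall (s t x y a : R) (A : set T), 0 <= s -> s <= t -> F s A ->
     0 <= x -> x < y -> 0 < a -> a < v t - v s ->
     (P A * (normal_peak 1 * expR (- (y / Num.sqrt a + 1) ^+ 2 / 2))%:E <=
      P (A `&` increment Y s t @^-1` `]x, +oo[))%E).
Implicit Types (s t x y : R) (w : T).

(** Completing the square: below the full scale, the shift by 1 in the lower tail estimate costs a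
    constant factor, uniformly in [u]. *)
Let gauss_exponent (r u : R) : 0 < r -> r < 1 ->
  (r * u + 1) ^+ 2 / 2 <= u ^+ 2 / 2 + (2^-1 + (2 * (1 - r ^+ 2))^-1).
Proof.
move=> r0 r1; have r2 : 0 < 1 - r ^+ 2 by nra.
rewrite -subr_ge0.
have -> : u ^+ 2 / 2 + (2^-1 + (2 * (1 - r ^+ 2))^-1) - (r * u + 1) ^+ 2 / 2 =
  (((1 - r ^+ 2) * u - r) ^+ 2 + (1 - r ^+ 2)) / (2 * (1 - r ^+ 2)).
  by field; rewrite gt_eqF.
apply: divr_ge0; last by rewrite mulr_ge0// ltW.
by rewrite addr_ge0 ?sqr_ge0// ltW.
Qed.

Section times.
Variables (k : R) (tt : nat -> R).
Hypotheses (k0 : 0 < k) (k1 : k < 1) (tt0 : forall n, 0 <= tt n)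
  (vtt : forall n, v (tt n) = (k ^- 2) ^+ n) (ttS : forall n, tt n < tt n.+1).

Let q : R := k ^- 2.
Let S n := lil_scale (q ^+ n).
(** Of the three factors [1 - k], one accounts for the variance, since [1 - k ^+ 2] exceeds
    [(1 - k) ^+ 2]; one makes the inequality between levels strict; one is the ratio [r < 1] for
    [gauss_exponent]. *)
Let G n := increment Y (tt n) (tt n.+1) @^-1` `]((1 - k) ^+ 3 * S n.+1), +oo[%classic.

Let q1 : 1 < q.
Proof. by rewrite /q -exprVn exprn_egt1// invf_gt1. Qed.

Let c : R := normal_peak 1 * expR (- (2^-1 + (2 * (1 - (1 - k) ^+ 2))^-1)).

Let c_gt0 : 0 < c.
Proof. by rewrite mulr_gt0 ?expR_gt0// normal_peak_gt0// oner_eq0. Qed.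

(* The increments over the disjoint intervals ]tt n, tt n.+1] exceed the LIL
   level with conditional probability at least of order 1 / n. *)
Let prob_G n A : expR 1 < q ^+ n.+1 -> F (tt n) A ->
  (P A * (c / ln (q ^+ n.+1))%:E <= P (A `&` G n))%E.
Proof.
move=> eq FA; have Sn0 := lil_scale_gt0 eq; rewrite -/(S n.+1) in Sn0.
have q0 : 0 < q by exact: lt_trans q1.
have qn0 : 0 < q ^+ n.+1 by rewrite exprn_gt0.
have k10 : 0 < 1 - k by rewrite subr_gt0.
pose a := (1 - k) ^+ 2 * q ^+ n.+1.
have a0 : 0 < a by rewrite mulr_gt0 ?exprn_gt0.
have x0 : 0 <= (1 - k) ^+ 3 * S n.+1 by rewrite mulr_ge0 ?exprn_ge0 ?(ltW k10)// (ltW Sn0).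
have xy : (1 - k) ^+ 3 * S n.+1 < (1 - k) ^+ 2 * S n.+1.
  rewrite ltr_pM2r// [X in X < _]exprS -subr_gt0.
  have -> : (1 - k) ^+ 2 - (1 - k) * (1 - k) ^+ 2 = k * (1 - k) ^+ 2 by ring.
  by rewrite mulr_gt0// exprn_gt0.
have av : a < v (tt n.+1) - v (tt n).
  rewrite !vtt -/q /a.
  have -> : q ^+ n = k ^+ 2 * q ^+ n.+1.
    by rewrite [q ^+ n.+1]exprS mulrA /q mulfV ?mul1r// expf_neq0// gt_eqF.
  rewrite -subr_gt0.
  have -> : q ^+ n.+1 - k ^+ 2 * q ^+ n.+1 - (1 - k) ^+ 2 * q ^+ n.+1 = 2 * k * (1 - k) * q ^+ n.+1 by ring.
  by rewrite !mulr_gt0.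
have := tail_ge (tt0 n) (ltW (ttS n)) FA x0 xy a0 av.
apply: le_trans; apply: lee_wpmul2l => //; rewrite lee_fin.
have LL := lnln_ge0 (ltW eq).
set u := Num.sqrt (2 * ln (ln (q ^+ n.+1))).
have u2 : u ^+ 2 / 2 = ln (ln (q ^+ n.+1)).
  by rewrite sqr_sqrtr ?mulr_ge0// mulrAC divff// mul1r.
have SE : S n.+1 = Num.sqrt (q ^+ n.+1) * u.
  rewrite /S /lil_scale /u -sqrtrM ?(ltW qn0)//; congr Num.sqrt; ring.
have -> : (1 - k) ^+ 2 * S n.+1 / Num.sqrt a = (1 - k) * u.
  rewrite /a sqrtrM ?sqr_ge0// sqrtr_sqr gtr0_norm// SE; field.
  by rewrite !gt_eqF ?sqrtr_gt0.
have l1 : 1 < ln (q ^+ n.+1) by rewrite -(expRK 1) ltr_ln ?posrE ?expR_gt0.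
have -> : c / ln (q ^+ n.+1) = normal_peak 1 *
   expR (- (ln (ln (q ^+ n.+1)) + (2^-1 + (2 * (1 - (1 - k) ^+ 2))^-1))).
  rewrite opprD expRD [expR (- ln _)]expRN lnK ?posrE ?(lt_trans ltr01 l1)//.
  by rewrite /c; ring.
rewrite ler_wpM2l ?normal_peak_ge0// ler_expR mulNr lerN2 -u2.
by apply: gauss_exponent => //; rewrite ltrBlDr ltrDl.
Qed.

Let avoid m n := \big[setI/setT]_(j < n) ~` G (m + j).

Let F_avoid m n : F (tt (m + n)) (avoid m n).
Proof.
rewrite /avoid; elim: n => [|n IH]; first by rewrite big_ord0; exact: (filtrationT hF).
have tl := tt0 (m + n.+1).
rewrite big_ord_recr/=; apply: (filtrationI hF tl).
  by apply: (uc_mono hF (tt0 (m + n)) _ IH); rewrite addnS; exact: ltW.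
apply: (filtrationC hF tl); rewrite addnS.
apply: (measurable_at_increment hF aY (tt0 _) (ltW (ttS _))).
exact: measurable_itv.
Qed.

Let measurable_G n : measurable (G n).
Proof.
apply: (filtration_measurable hF (tt0 n.+1)).
apply: (measurable_at_increment hF aY (tt0 _) (ltW (ttS _))).
exact: measurable_itv.
Qed.

(** The second Borel-Cantelli lemma in conditional form: given the past, each avoidance has
    probability at most [1 - p <= expR (- p)], and the exponents add up. *)
Let prob_avoid m n : (forall j, (m <= j)%N -> expR 1 < q ^+ j) ->
  (P (avoid m n) <= (expR (- \sum_(j < n) c / (m.+1%:R * ln q) / j.+1%:R))%:E)%E.
Proof.
move=> hm; elim: n => [|n IH].
  by rewrite /avoid !big_ord0 oppr0 expR0 probability_setT.
have FA := F_avoid m n.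
have mA := filtration_measurable hF (tt0 _) FA.
rewrite /avoid big_ord_recr/= -/(avoid m n) -setDE measureD//; last first.
  exact: (le_lt_trans (probability_le1 P mA) (ltry 1)).
have em : expR 1 < q ^+ (m + n).+1 by apply: hm; rewrite ltnW// ltnS leq_addr.
have HG := prob_G em FA.
have lq : 0 < ln q by exact: ln_gt0.
(* Since [m + n + 1 <= (m + 1) * (n + 1)], this is below the true rate and, for fixed [m], a
   multiple of the harmonic term in [n]. *)
set p := c / (m.+1%:R * ln q) / n.+1%:R.
have pp : p <= c / ln (q ^+ (m + n).+1).
  rewrite /p -mulrA ler_pM2l// lnXn ?(lt_trans ltr01)// -[ln q *+ _]mulr_natr.
  have -> : (m.+1%:R * ln q)^-1 / n.+1%:R = (ln q * (m.+1 * n.+1)%:R)^-1.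
    by rewrite natrM !invfM; ring.
  rewrite lef_pV2 ?posrE ?mulr_gt0 ?ltr0n// ler_pM2l// ler_nat.
  by rewrite mulSn mulnS addSn ltnS addnA [(n + m)%N]addnC leq_addr.
have HP : (P (avoid m n) * p%:E <= P (avoid m n `&` G (m + n)))%E.
  by apply: le_trans HG; apply: lee_wpmul2l => //; rewrite lee_fin.
rewrite big_ord_recr/= -/p opprD expRD.
have [x xE] : exists x : R, P (avoid m n) = x%:E.
  by exists (fine (P (avoid m n))); rewrite fineK//; exact: fin_num_measure.
have [y yE] : exists y : R, P (avoid m n `&` G (m + n)) = y%:E.
  exists (fine (P (avoid m n `&` G (m + n)))); rewrite fineK//.
  by apply: fin_num_measure; exact: measurableI.
have x0 : 0 <= x by rewrite -lee_fin -xE measure_ge0.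
move: HP IH; rewrite xE yE -EFinM -EFinB !lee_fin => HP IH.
apply: (@le_trans _ _ (x * expR (- p))); last by rewrite ler_wpM2r ?expR_ge0.
have := expR_ge1Dx (- p); nra.
Qed.

Lemma geometric_exceeds_io n0 : (forall j, (n0 <= j)%N -> expR 1 < q ^+ j) ->
  {ae P, forall w, forall m, exists2 n, (m <= n)%N &
    (1 - k) ^+ 3 * S n.+1 < Y (tt n.+1) w - Y (tt n) w}.
Proof.
move=> hn0; apply/ae_foralln => m.
pose m' := maxn m n0.
have hm j : (m' <= j)%N -> expR 1 < q ^+ j.
  by rewrite geq_max => /andP[_]; exact: hn0.
pose N := \bigcap_n avoid m' n.
have mN : measurable N.
  by apply: bigcapT_measurable => n; exact: (filtration_measurable hF (tt0 _) (F_avoid _ _)).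
have N0 : P N = 0%E.
  apply/eqP; rewrite eq_le measure_ge0 andbT; apply/lee_addgt0Pr => e e0.
  have cm : 0 < c / (m'.+1%:R * ln q) by rewrite divr_gt0// mulr_gt0// ln_gt0.
  have [n Hn] := harmonic_unbounded (- ln e) cm.
  rewrite add0e; apply: (@le_trans _ _ (P (avoid m' n))).
    apply: le_measure; rewrite ?inE//.
      exact: (filtration_measurable hF (tt0 _) (F_avoid _ _)).
    exact: bigcap_inf.
  apply: (le_trans (prob_avoid n hm)); rewrite lee_fin -[leRHS](@lnK R)// ler_expR.
  by rewrite lerNl.
apply: (@negligibleS _ _ _ _ N); last by apply/negligibleP.
move=> w nE n _; rewrite /avoid -(bigcap_mkord _ (fun j => ~` G (m' + j))) => j /= jn Gj.
apply: nE; exists (m' + j)%N; first by rewrite (leq_trans (leq_maxl m n0))// leq_addr.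
by move: Gj; rewrite /G /= in_itv/= andbT.
Qed.

End times.

Theorem lil_lower (e : R) : 0 < e -> e <= 1 ->
  {ae P, forall w, \forall t \near +oo, - Y t w <= 2 * lil_scale (v t)} ->
  {ae P, forall w, forall M, exists2 t, M < t & (1 - e) * lil_scale (v t) <= Y t w}.
Proof.
(* The loss is at most [5 * k]: [(1 - k) ^+ 3 >= 1 - 3 * k] for the increment, and [2 * k] for the
   value at the preceding time, as [lil_scale] shrinks by the factor [k] when the variance is
   divided by [k ^- 2]. *)
move=> e0 e1 low; pose k := e / 8.
have k0 : 0 < k by rewrite /k; lra.
have k1 : k < 1 by rewrite /k; lra.
have q1 : 1 < k ^- 2 by rewrite -exprVn exprn_egt1// invf_gt1.
have [tt [tt0 vtt ttS ttoo]] := geometric_times v_homo v_onto q1.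
have [n0 Hn0] := expr_unbounded (expR 1) q1.
have tt_homo : forall i j, (i <= j)%N -> tt i <= tt j.
  move=> i; elim => [|j IH]; first by rewrite leqn0 => /eqP->.
  by rewrite leq_eqVlt => /predU1P[->//|/IH /le_trans]; apply; rewrite ltW.
have io := geometric_exceeds_io k0 k1 tt0 vtt ttS Hn0.
apply: filterS2 low io => w [T0 [_ lowT0]] io M.
have [m1 Hm1] := ttoo (Num.max M T0).
have [n mn Hn] := io (maxn m1 n0).
move: mn; rewrite geq_max => /andP[m1n n0n].
move: Hm1; rewrite gt_max => /andP[Mm1 T0m1].
exists (tt n.+1).
  by apply: (lt_trans Mm1); apply: (le_lt_trans (tt_homo _ _ m1n)).
have := lowT0 (tt n) (lt_le_trans T0m1 (tt_homo _ _ m1n)).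
rewrite !vtt.
have SS : lil_scale ((k ^- 2) ^+ n) <= k * lil_scale ((k ^- 2) ^+ n.+1).
  have qq : k ^- 2 * (k ^- 2) ^+ n <= (k ^- 2) ^+ n.+1 by rewrite -exprS.
  have qn : (k ^- 2) ^+ n <= (k ^- 2) ^+ n.+1 by rewrite ler_eXn2l.
  have := lil_scaleM (lt_trans ltr01 q1) (ltW (Hn0 _ n0n)) qq qn.
  rewrite -exprVn sqrtr_sqr gtr0_norm ?invr_gt0// exprVn.
  by rewrite ler_pdivrMl.
have S0 := lil_scale_gt0 (Hn0 n.+1 (leqW n0n)).
move: Hn SS S0; move: (lil_scale _) (lil_scale _) (Y _ w) (Y _ w) => S0 S1 y0 y1 H1 H2 H3 H4.

have kk : 1 - 3 * k <= (1 - k) ^+ 3 by rewrite !exprS expr0; nra.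
have : (1 - 3 * k) * S1 <= (1 - k) ^+ 3 * S1 by rewrite ler_wpM2r// ltW.
have -> : e = 8 * k by rewrite /k; lra.
nra.
Qed.

End lil_lower.

(** * The variance of the Wiener integral and its two-sided bounds *)

Section int_sqr_theory.
Context {R : realType} (sigma : R -> R).
Hypothesis csigma : {within `[0, +oo[, continuous sigma}.
Implicit Types s t b c : R.
Local Notation mu := (@lebesgue_measure R).
Local Notation v := (int_sqr sigma).

Let csigma2 : {within `[0, +oo[, continuous (fun x => sigma x ^+ 2)}.
Proof.
by apply: (@within_continuous_comp _ _ (fun y => y ^+ 2)) => //; exact: sqr_continuous.
Qed.

Lemma int_sqr0 : v 0 = 0.
Proof. by rewrite /int_sqr set_itv1 Rintegral_set1. Qed.

Lemma int_sqrB s t : 0 <= s -> s <= t ->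
  \int[mu]_(x in `[s, t]) sigma x ^+ 2 = v t - v s.
Proof.
move=> s0 st; rewrite /int_sqr.
by rewrite (Rintegral_itv_split (halfline_integrable t csigma2 (lexx 0)) s0 st) addrAC subrr add0r.
Qed.

Lemma int_sqr_homo s t : 0 <= s -> s <= t -> v s <= v t.
Proof.
move=> s0 st; rewrite -subr_ge0 -int_sqrB//.
by apply: Rintegral_ge0 => x _; exact: sqr_ge0.
Qed.

Lemma int_sqr_ge0 t : 0 <= t -> 0 <= v t.
Proof. by move=> t0; rewrite -int_sqr0 int_sqr_homo. Qed.

Lemma int_sqr_continuous t : 0 < t -> {for t, continuous v}.
Proof.
move=> t0; have [d _] := halfline_FTC csigma2 t0.
by apply: differentiable_continuous; exact/derivable1_diffP.
Qed.

Hypothesis sigma_L2 : ~ mu.-integrable `]0, +oo[ (fun s : R => (sigma s ^+ 2)%:E).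

(** Otherwise monotone convergence along [[0, n]] would make the nonnegative function [sigma ^+ 2]
    integrable on the half-line. *)
Lemma int_sqr_unbounded c : exists2 t, 0 <= t & c < v t.
Proof.
apply: contrapT => /forall2NP H; apply: sigma_L2.
have vc t : 0 <= t -> v t <= c.
  by move=> t0; have [//|/negP] := H t; rewrite -leNgt.
have mI : measurable_fun `[(0 : R), +oo[%classic (fun s : R => (sigma s ^+ 2)%:E).
  apply/measurable_EFinP; apply: subspace_continuous_measurable_fun => //.
apply: (@integrableS _ (measurableTypeR R) R mu `[(0 : R), +oo[%classic) => //.
  by move=> x /=; rewrite !in_itv/= !andbT => /ltW.
apply/integrableP; split => //.
have E : (\bigcup_n `[0, n%:R] = `[0, +oo[ :> set R)%classic.
  apply/seteqP; split => [x [n _]|x] /=; rewrite !in_itv/=.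
    by move=> /andP[->].
  rewrite andbT => x0; exists (Num.truncn x).+1 => //=.
  by rewrite in_itv/= x0 ltW// truncnS_gt.
have cvg : (\int[mu]_(x in `[0%R, n%:R]) `|(sigma x ^+ 2)%:E| @[n --> \oo] -->
    \int[mu]_(x in \bigcup_n `[0%R, n%:R]%classic) `|(sigma x ^+ 2)%:E|)%E.
  apply: (@ge0_nondecreasing_set_cvg_integral _ (measurableTypeR R) R
    (fun n => `[0%R, n%:R]%classic) (fun x => `|(sigma x ^+ 2)%:E|%E) mu) => //.
  - move=> m n mn; apply/subsetPset => x /=; rewrite !in_itv/= => /andP[-> xm].
    by rewrite (le_trans xm)// ler_nat.
  - move=> n; apply: measurableT_comp => //; apply: measurable_funS mI => //.
    by move=> x /=; rewrite !in_itv/= => /andP[->].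
rewrite -E -(cvg_lim (@ereal_hausdorff R) cvg).
apply: (@le_lt_trans _ _ c%:E); last exact: ltry.
apply: lime_le; first by apply/cvg_ex; eexists; exact: cvg.
apply: nearW => n.
have i2 := halfline_integrable n%:R csigma2 (lexx 0).
have := vc n%:R (ler0n _ _); rewrite -lee_fin /int_sqr /Rintegral fineK.
  apply: le_trans; rewrite le_eqVlt; apply/orP; left; apply/eqP.
  by apply: eq_integral => x _; rewrite gee0_abs// lee_fin sqr_ge0.
by apply: (integrable_fin_num _ i2).
Qed.

Lemma int_sqr_onto c : 0 < c -> exists2 t, 0 <= t & v t = c.
Proof.
move=> c0; have [b b0 cb] := int_sqr_unbounded c.
have cv : {within `[0, b], continuous v}.
  exact: (parameterized_integral_continuous b0 (halfline_integrable b csigma2 (lexx 0))).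
have [|t] := IVT b0 cv (v := c).
- by rewrite int_sqr0 min_l ?int_sqr_ge0// max_r ?int_sqr_ge0// (ltW c0) (ltW cb).
- by rewrite in_itv/= => /andP[t0 _]; exists t.
Qed.

End int_sqr_theory.

Section wiener_lil.
Context {R : realType} {d : measure_display} {T : measurableType d}
  (P : probability T R) (F : R -> set_system T) (sigma : R -> R) (B I : R -> T -> R).
Hypotheses (hF : usual_conditions P F) (hB : brownian_motion P F B)
  (csigma : {within `[0, +oo[, continuous sigma})
  (hI : wiener_integral P F B sigma I).
Implicit Types (s t x y a b e : R) (A : set T).
Local Notation v := (int_sqr sigma).

(** The bound by one half holds for every variance, so any window around the true one serves. *)
Let band (V : R) : V - 1 < V < V + 1. Proof. by apply/andP; split; lra. Qed.

Let wiener_half s t e A : 0 <= s -> s <= t -> F s A -> 0 < e ->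
  (P A * (2^-1)%:E <= P (A `&` increment I s t @^-1` `](- e)%R, +oo[))%E.
Proof.
move=> s0 st FA e0; have e2 : 0 < e / 2 by lra.
have ee : - e < - (e / 2) by lra.
apply: (wiener_increment_ge hF hB csigma hI s0 st FA ee (band _)) => u u0 _.
exact: (bm_law_half hB).
Qed.

Let wiener_tail_le t x y b : 0 <= t -> 0 < y -> y < x -> v t < b ->
  (P (increment I 0 t @^-1` `]x, +oo[) <= (expR (- (y ^+ 2) / (b *+ 2)))%:E)%E.
Proof.
move=> t0 y0 yx vb.
have Vb : v t - 1 < \int[lebesgue_measure]_(x in `[0, t]) sigma x ^+ 2 < b.
  by apply/andP; split => //; rewrite -/(v t); lra.
have b0 : 0 < b := le_lt_trans (int_sqr_ge0 csigma t0) vb.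
apply: (wiener_increment_le hF hB csigma hI (lexx 0) t0 yx Vb) => u u0 /andP[_ ub].
exact: (bm_law_tail_le hB).
Qed.

Let wiener_tail_ge s t x y a A : 0 <= s -> s <= t -> F s A ->
     0 <= x -> x < y -> 0 < a -> a < v t - v s ->
  (P A * (normal_peak 1 * expR (- (y / Num.sqrt a + 1) ^+ 2 / 2))%:E <=
   P (A `&` increment I s t @^-1` `]x, +oo[))%E.
Proof.
move=> s0 st FA x0 xy a0; rewrite -int_sqrB// => aV.
have Vb : a < \int[lebesgue_measure]_(x in `[s, t]) sigma x ^+ 2 <
    \int[lebesgue_measure]_(x in `[s, t]) sigma x ^+ 2 + 1.
  by rewrite aV ltrDl ltr01.
apply: (wiener_increment_ge hF hB csigma hI s0 st FA xy Vb) => u u0 /andP[au _].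
by apply: (bm_law_tail_ge hB) => //; exact: ltW (le_lt_trans x0 xy).
Qed.

Hypothesis sigma_L2 :
  ~ lebesgue_measure.-integrable `]0, +oo[ (fun s : R => (sigma s ^+ 2)%:E).

Lemma wiener_integral_upper e : 0 < e ->
  {ae P, forall w, \forall t \near +oo, I t w <= (1 + e) * Sigma sigma t}.
Proof.
move=> e0; apply: (lil_upper hF (wi_adapted hI) (wi_continuous hI) wiener_half) => //.
- exact: int_sqr_homo.
- exact: int_sqr_onto.
Qed.

Lemma wiener_integral_lower e : 0 < e -> e <= 1 ->
  {ae P, forall w, \forall t \near +oo, - I t w <= 2 * Sigma sigma t} ->
  {ae P, forall w, forall M, exists2 t, M < t & (1 - e) * Sigma sigma t <= I t w}.
Proof.
move=> e0 e1; apply: (lil_lower hF (wi_adapted hI) _ _ wiener_tail_ge) => //.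
- exact: int_sqr_homo.
- exact: int_sqr_onto.
Qed.

End wiener_lil.

Section wiener_opp.
Context {R : realType} {d : measure_display} {T : measurableType d}
  (P : probability T R) (F : R -> set_system T) (sigma : R -> R) (B I : R -> T -> R).
Hypotheses (hF : usual_conditions P F).

Let step_opp (p : step R) : step R := Step (- step_height p) (step_wf p).

Let step_fun_opp (s : seq (step R)) x : step_fun (map step_opp s) x = - step_fun s x.
Proof.
rewrite /step_fun big_map -sumrN; apply: eq_bigr => p _; exact: mulNr.
Qed.

Let step_integral_opp (s : seq (step R)) t w :
  step_integral B (map step_opp s) t w = - step_integral B s t w.
Proof.
rewrite /step_integral big_map -sumrN; apply: eq_bigr => p _; exact: mulNr.
Qed.

Lemma int_sqrN : int_sqr (\- sigma) = int_sqr sigma.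
Proof.
apply/funext => t; rewrite /int_sqr; apply: eq_Rintegral => x _.
exact: sqrrN.
Qed.

(** The sign goes into the step heights, not into [B], so the Brownian motion stays the same; the
    variance is unchanged by [int_sqrN]. *)
Lemma wiener_integralN : wiener_integral P F B sigma I ->
  wiener_integral P F B (\- sigma) (fun t w => - I t w).
Proof.
move=> hI; split.
- move=> t t0.
  have := measurable_atZ hF (-1) t0 (wi_adapted hI t0).
  by under eq_fun do rewrite mulN1r.
- apply: filterS (wi_continuous hI) => w cI.
  by apply: (@within_continuous_comp _ _ -%R (fun t => I t w) cI); exact: opp_continuous.
- move=> t t0; have [s [h1 h2]] := wi_limit hI t0.
  exists (fun n => map step_opp (s n)); split.
    rewrite (_ : (fun n => _) = (fun n => \int[lebesgue_measure]_(x in `[0%R, t])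
       ((step_fun (s n) x - sigma x) ^+ 2)%:E)%E)//.
    apply/funext => n; apply: eq_integral => x _.
    by rewrite step_fun_opp /= -opprD sqrrN.
  move=> u u0 ut.
  rewrite (_ : (fun n => _) =
    (fun n => 'E_P[fun w => ((I u w - step_integral B (s n) u w) ^+ 2)%R])%E); first exact: h2.
  apply/funext => n; congr ('E_P[_])%E; apply/funext => w.
  by rewrite step_integral_opp -opprD sqrrN.
Qed.

End wiener_opp.

(** * From almost sure bounds to limits superior *)

Section limits_of_ratios.
Context {R : realType}.
Implicit Types (u X I S : R -> R) (c e : R).

Lemma limf_esup_pinfty u c :
  (forall e, 0 < e -> \forall t \near +oo, u t <= c + e) ->
  (forall e M, 0 < e -> exists2 t, M < t & c - e <= u t) ->
  limf_esup (fun t => (u t)%:E) (pinfty_nbhs R) = c%:E.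
Proof.
move=> hle hge; apply/eqP; rewrite eq_le; apply/andP; split.
  apply/lee_addgt0Pr => e e0; have [M [Mr HM]] := hle e e0.
  apply: ge_ereal_inf; exists (ereal_sup [set (u t)%:E | t in [set t | u t <= c + e]]).
    by exists [set t | u t <= c + e] => //; exists M.
  by apply: ge_ereal_sup => _ [t /= ut <-]; rewrite -EFinD lee_fin.
apply: le_ereal_inf_tmp => _ [V [M [Mr HM]] <-].
apply/lee_addgt0Pr => e e0; have [t Mt ut] := hge e M e0.
apply: (@le_trans _ _ ((u t)%:E + e%:E)%E); first by rewrite -EFinD lee_fin -lerBlDr.
by apply: leeD => //; apply: ereal_sup_ubound; exists t => //; exact: HM.
Qed.

(** Half of each tolerance covers the negligible difference [X - I], the other half the error
    [n.+1%:R^-1]. *)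
Lemma limf_esup_ratio X I S :
  (\forall t \near +oo, 0 < S t) ->
  (X t - I t) / S t @[t --> +oo] --> (0 : R) ->
  (forall n, \forall t \near +oo, I t <= (1 + n.+1%:R^-1) * S t) ->
  (forall n M, exists2 t, M < t & (1 - n.+1%:R^-1) * S t <= I t) ->
  limf_esup (fun t => (X t / S t)%:E) (pinfty_nbhs R) = 1%:E.
Proof.
move=> S0 /cvgr0Pnorm_le D0 hle hge.
have inv e : 0 < e -> exists n, n.+1%:R^-1 <= e / 2.
  move=> e0; exists (Num.truncn (2 / e)).
  by rewrite invf_ple ?posrE ?divr_gt0// invf_div ltW// truncnS_gt.
apply: limf_esup_pinfty => [e e0|e M e0].
  have [n Hn] := inv e e0; have e2 : 0 < e / 2 by lra.
  near=> t.
  have St : 0 < S t by near: t.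
  have It : I t <= (1 + n.+1%:R^-1) * S t by near: t; exact: hle.
  have Dt : `|(X t - I t) / S t| <= e / 2 by near: t; exact: D0.
  move: Dt; rewrite ler_norml => /andP[_]; rewrite !ler_pdivrMr// => Dt.
  have : (1 + n.+1%:R^-1) * S t <= (1 + e / 2) * S t by rewrite ler_pM2r// lerD2l.
  move=> /(le_trans It); move: (S t) (X t) (I t) Dt {It St} => s x i *; lra.
have [n Hn] := inv e e0; have e2 : 0 < e / 2 by lra.
have [M1 [_ HM1]] := S0; have [M2 [_ HM2]] := D0 _ e2.
have [t] := hge n (Num.max M (Num.max M1 M2)).
rewrite !gt_max => /and3P[Mt M1t M2t] It; exists t => //.
have St := HM1 t M1t; have := HM2 t M2t; rewrite /= ler_norml => /andP[+ _].
rewrite !ler_pdivlMr// => Dt.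
have : (1 - e / 2) * S t <= (1 - n.+1%:R^-1) * S t by rewrite ler_pM2r// lerD2l lerN2.
by move=> /le_trans /(_ It); move: (S t) (X t) (I t) Dt {It St} => s x i *; lra.
Unshelve. all: by end_near. Qed.

End limits_of_ratios.

Section Sigma_theory.
Context {R : realType} (sigma : R -> R) (t0 : R).
Hypotheses (csigma : {within `[0, +oo[, continuous sigma}) (t0_ge0 : 0 <= t0)
  (ht0 : expR 1 < int_sqr sigma t0).

Let v_gt t : t0 <= t -> expR 1 < int_sqr sigma t.
Proof. by move=> tt; apply: (lt_le_trans ht0); exact: int_sqr_homo. Qed.

Lemma Sigma_gt0 t : t0 <= t -> 0 < Sigma sigma t.
Proof. by move=> /v_gt; exact: lil_scale_gt0. Qed.

Lemma Sigma_continuous : {within `[t0, +oo[, continuous (Sigma sigma)}.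
Proof.
(* The variance vanishes at 0, so the hypothesis on [t0] excludes 0, and continuity holds on both
   sides at every point of [[t0, +oo[]. *)
have t0_gt0 : 0 < t0.
  rewrite lt_neqAle t0_ge0 andbT; apply: contraTneq ht0 => <-.
  by rewrite int_sqr0 -leNgt expR_ge0.
apply: continuous_in_subspaceT => t; rewrite inE/= in_itv/= andbT => tt.
have t_gt0 := lt_le_trans t0_gt0 tt.
have cv := int_sqr_continuous csigma t_gt0.
have vt := v_gt tt.
have v0 : 0 < int_sqr sigma t by apply: lt_trans vt; exact: expR_gt0.
have l1 := ln_ge1 (ltW vt).
have cl : {for t, continuous (fun t => ln (int_sqr sigma t))}.
  exact: (cvg_comp _ _ cv (continuous_ln v0)).
have cll : {for t, continuous (fun t => ln (ln (int_sqr sigma t)))}.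
  exact: (cvg_comp _ _ cl (continuous_ln (lt_le_trans ltr01 l1))).
have cp : {for t, continuous (fun t => 2 * int_sqr sigma t * ln (ln (int_sqr sigma t)))}.
  by apply: cvgM => //; apply: cvgM => //; exact: cvg_cst.
exact: (cvg_comp _ _ cp (@sqrt_continuous R _)).
Qed.

End Sigma_theory.

Section mu_upto_theory.
Context {R : realType} (mu : {measure set (measurableTypeR R) -> \bar R}).
Hypothesis mu_fin : (mu `[0%R, +oo[%classic < +oo)%E.

Let mu_le (A : set R) : measurable A -> A `<=` `[0%R, +oo[%classic ->
  (mu A <= mu `[0%R, +oo[%classic)%E.
Proof. by move=> mA AS; apply: le_measure; rewrite ?inE//; exact: measurable_itv. Qed.

Let itv_sub (t : R) : `[0, t]%classic `<=` `[0, +oo[%classic.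
Proof. by move=> x /=; rewrite !in_itv/= andbT => /andP[]. Qed.

Let mu_fin_num (t : R) : mu `[0, t]%classic \is a fin_num.
Proof.
rewrite ge0_fin_numE ?measure_ge0//; apply: le_lt_trans mu_fin.
by apply: mu_le; [exact: measurable_itv|exact: itv_sub].
Qed.

Lemma mu_upto_homo : {homo mu_upto mu : s t / s <= t}.
Proof.
move=> s t st; apply: fine_le => //.
apply: le_measure; rewrite ?inE; [exact: measurable_itv|exact: measurable_itv|].
by move=> x /=; rewrite !in_itv/= => /andP[-> /le_trans]; apply.
Qed.

Lemma mu_upto_bound t : 0 <= mu_upto mu t <= fine (mu `[0, +oo[%classic).
Proof.
rewrite fine_ge0 ?measure_ge0//=; apply: fine_le => //.
  by rewrite ge0_fin_numE// measure_ge0.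
by apply: mu_le; [exact: measurable_itv|exact: itv_sub].
Qed.

End mu_upto_theory.

Theorem theorem3p9 (R : realType) (d : measure_display) (T : measurableType d)
  (P : probability T R) (F : R -> set_system T)
  (mu : {measure set (measurableTypeR R) -> \bar R})
  (sigma f phi dphi : R -> R) (B I X : R -> T -> R) (t0 : R)
  (hF : usual_conditions P F)
  (hmu : (0 < mu `[0%R, +oo[%classic < +oo)%E)
  (hsigma : {within `[0, +oo[, continuous sigma})
  (hsigma_L2 : ~ lebesgue_measure.-integrable `]0, +oo[
                   (fun s : R => (sigma s ^+ 2)%:E))
  (hB : brownian_motion P F B)
  (hf_lip : locally_lipschitz f)
  (hf_lim : f x @[x --> +oo] --> +oo)
  (hphi_C1 : C1_halfline phi dphi)
  (hphi_pos : forall x, 0 <= x -> 0 < phi x)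
  (hdphi_pos : forall x, 0 <= x -> 0 < dphi x)
  (hphi_lim : phi x @[x --> +oo] --> +oo)
  (hdphi_mono : forall x y, 0 <= x -> x <= y -> dphi y <= dphi x)
  (hdphi_lim : dphi x @[x --> +oo] --> (0 : R))
  (hf_phi : f x / phi x @[x --> +oo] --> (1 : R))
  (hf_phi_abs : `|f x| / phi `|x| @[x --> norm_pinfty_nbhs R] --> (1 : R))
  (hI : wiener_integral P F B sigma I)
  (hX : volterra_solution P F mu f I X)
  (ht0 : 0 <= t0)
  (ht0_e : expR 1 < int_sqr sigma t0)
  (hLf : Lf_quotient mu f sigma t0 t @[t --> +oo] --> +oo) :
  [/\ {ae P, forall w,
         limf_einf (fun t => (X t w / Sigma sigma t)%:E) (pinfty_nbhs R)
           = (-1)%:E},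
      {ae P, forall w,
         limf_esup (fun t => (X t w / Sigma sigma t)%:E) (pinfty_nbhs R)
           = 1%:E} &
      {ae P, forall w,
         (X t w - I t w) / Sigma sigma t @[t --> +oo] --> (0 : R)}].
Proof.
set S := Sigma sigma.
have cf : continuous f := locally_lipschitz_continuous hf_lip.
have M_gt0 : 0 < fine (mu `[0%R, +oo[%classic).
  by apply: fine_gt0.
have mu_fin : (mu `[0%R, +oo[%classic < +oo)%E by case/andP: hmu.
have S_gt0 := Sigma_gt0 hsigma ht0 ht0_e.
have S_ev : \forall t \near +oo, 0 < S t.
  by near=> t; apply: S_gt0; near: t; exact: nbhs_pinfty_ge (num_real _).
have S_lim : S t @[t --> +oo] --> +oo.
  apply: lil_scale_cvg; first exact: int_sqr_homo.
  exact: int_sqr_onto.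
have csigmaN : {within `[0, +oo[, continuous (\- sigma)}.
  by apply: (@within_continuous_comp _ _ -%R sigma hsigma); exact: opp_continuous.
have hsigmaN_L2 : ~ lebesgue_measure.-integrable `]0, +oo[
   (fun s : R => ((\- sigma) s ^+ 2)%:E).
  by move=> h; apply: hsigma_L2; apply: eq_integrable h => // x _; rewrite /= sqrrN.
have hIN := wiener_integralN hF hI.
have upper (e : R) (e0 : 0 < e) := wiener_integral_upper hF hB hsigma hI hsigma_L2 e0.
have upperN (e : R) : 0 < e -> {ae P, forall w, \forall t \near +oo, - I t w <= (1 + e) * S t}.
  move=> e0; have := wiener_integral_upper hF hB csigmaN hIN hsigmaN_L2 e0.
  by rewrite /Sigma int_sqrN.
(* The upper bounds with margin 1 give the crude factor 2 that the lower bounds require for the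
   opposite sign and the drift requires for [|I|]. *)
have two : (2 : R) = 1 + 1 by [].
have lower (e : R) : 0 < e -> e <= 1 ->
    {ae P, forall w, forall M, exists2 t, M < t & (1 - e) * S t <= I t w}.
  move=> e0 e1; apply: (wiener_integral_lower hF hB hsigma hI hsigma_L2 e0 e1).
  by rewrite two; exact: upperN.
have lowerN (e : R) : 0 < e -> e <= 1 ->
    {ae P, forall w, forall M, exists2 t, M < t & (1 - e) * S t <= - I t w}.
  move=> e0 e1; have := wiener_integral_lower hF hB csigmaN hIN hsigmaN_L2 e0 e1.
  rewrite /Sigma int_sqrN; apply; rewrite two.
  by apply: filterS (upper 1 ltr01) => w; apply: filterS => t; rewrite opprK.
have n0 n : 0 < (n.+1%:R^-1 : R) by [].
have n1 n : (n.+1%:R^-1 : R) <= 1 by rewrite invf_le1// ler1n.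
have drift : {ae P, forall w, (X t w - I t w) / S t @[t --> +oo] --> (0 : R)}.
  have ub := upper 1 ltr01; have lb := upperN 1 ltr01.
  have [_ Xc Xe] := hX; move: Xe; apply: filterS3 Xc (filterI ub lb) => w cXw [ubw lbw] eqw.
  apply: (drift_negligible hphi_C1 hphi_pos hdphi_pos hdphi_mono cf hf_phi hf_phi_abs
    (Sigma_continuous hsigma ht0 ht0_e) M_gt0 ht0 S_gt0 S_lim hLf
    (mu_upto_homo mu_fin) (mu_upto_bound mu_fin) cXw eqw).
  by apply: filterS2 ubw lbw => t; rewrite -two ler_norml lerNl => -> ->.
(* Restricting the margins to [n.+1%:R^-1] leaves countably many almost sure statements, hence a
   single exceptional null set. *)
have /ae_foralln upper_n : forall n,
    {ae P, forall w, \forall t \near +oo, I t w <= (1 + n.+1%:R^-1) * S t}.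
  by move=> n; exact: upper.
have /ae_foralln upperN_n : forall n,
    {ae P, forall w, \forall t \near +oo, - I t w <= (1 + n.+1%:R^-1) * S t}.
  by move=> n; exact: upperN.
have /ae_foralln lower_n : forall n,
    {ae P, forall w, forall M, exists2 t, M < t & (1 - n.+1%:R^-1) * S t <= I t w}.
  by move=> n; exact: lower.
have /ae_foralln lowerN_n : forall n,
    {ae P, forall w, forall M, exists2 t, M < t & (1 - n.+1%:R^-1) * S t <= - I t w}.
  by move=> n; exact: lowerN.
split => //.
- apply: filterS3 drift upperN_n lowerN_n => w Dw uw lw.
  (* The limit inferior is by definition minus the limit superior of the opposite, so the same ratio
     lemma applies to [- X] and [- I]. *)
  rewrite EFinN /limf_einf; congr oppe.
  rewrite -(@limf_esup_ratio R (fun t => - X t w) (fun t => - I t w) S) //.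
    by congr limf_esup; apply/funext => t; rewrite /= mulNr EFinN.
  rewrite (_ : (fun t => _) = (fun t => - ((X t w - I t w) / S t))).
    by rewrite -oppr0; exact: cvgN.
  by apply/funext => t; rewrite -opprD mulNr.
- apply: filterS3 drift upper_n lower_n => w Dw uw lw.
  exact: (@limf_esup_ratio R (fun t => X t w) (fun t => I t w) S).
Unshelve. all: by end_near. Qed.
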